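(* Let $G=(V,E)$ be a vertex-transitive graph. (1) If $G$ is transient, then $\displaystyle\liminf_{n\to\infty}\frac{H(R_n)}{\langle R_n\rangle}>0$. (2) If $G$ is recurrent, then $\displaystyle\frac{H(R_n)}{\langle R_n\rangle}\longrightarrow 0$ as $n\to\infty$.
   Context: $G=(V,E)$ is a graph with vertex set $V$ and edges given by unordered pairs of vertices; $x\sim y$ means $\{x,y\}\in E$, and $\deg(x)$ is the number of neighbors of $x$, always assumed finite, and at least $1$ so that the walk below is defined. The graph distance $d(x,y)$ is the length of a shortest path from $x$ to $y$ ($\infty$ if there is none). $G$ is vertex-transitive if for every pair of vertices $(x,x')$ there is a bijection $\phi:V\to V$ with $\phi(x)=x'$ and $d(y,y')=d(\phi(y),\phi(y'))$ for all $y,y'\in V$. For $o\in V$, $P_o$ (with expectation $E_o$) is the law of the simple random walk $(X_n)_{n\ge 0}$ on $G$ started at $X_0=o$, i.e. the Markov chain with transition probabilities $p(x,y)=1/\deg(x)$ if $x\sim y$ and $0$ otherwise. The range is $R_n=\{X_0,X_1,\dots,X_n\}$, its expected size is $\langle R_n\rangle_o=E_o[|R_n|]$, and its entropy is $H_o(R_n)=\sum_{A}P_o[R_n=A]\log\big(1/P_o[R_n=A]\big)$, the sum being over all finite connected sets $A\subseteq V$ containing $o$, with $0\log(1/0)=0$. On a vertex-transitive graph these quantities do not depend on $o$ and are written $\langle R_n\rangle$ and $H(R_n)$. $G$ is transient if $P_o[o\notin\{X_1,X_2,\dots\}]>0$ for every $o\in V$, and recurrent if this probability is $0$ for every $o\in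 V$ (a vertex-transitive graph is one or the other). *)

(* Defs.v *)
From HB Require Import structures.
From mathcomp Require Export all_boot all_order all_algebra.
From mathcomp Require Export finmap.
From mathcomp Require Export all_classical all_reals all_analysis.

Set Implicit Arguments.
Unset Strict Implicit.
Unset Printing Implicit Defensive.

Import Order.TTheory GRing.Theory Num.Theory.
Import numFieldNormedType.Exports.

Local Open Scope classical_set_scope.
Local Open Scope ring_scope.

Section Graph.
Context {V : choiceType}.
Implicit Types (E : rel V) (x y : V) (A : {fset V}).

Definition locally_finite E := forall x, finite_set [set y | E x y].

(* [fset_set] sends infinite sets to [fset0]: only meaningful for locally
   finite graphs. *)
Definition deg E x : nat := #|` fset_set [set y | E x y]|.

(* The infimum of the lengths of all walks from [x] to [y]; it is attained by a
   shortest path when there is one and is [+oo] otherwise. *)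
Definition gdist (R : realType) E x y : \bar R :=
  ereal_inf [set ((size p)%:R)%:E | p in [set p | path E x p /\ last x p = y]].

Definition vertex_transitive (R : realType) E : Prop :=
  forall x x', exists phi : V -> V,
    [/\ bijective phi, phi x = x' &
        forall y y', gdist R E y y' = gdist R E (phi y) (phi y')].

(* Connectedness of the subgraph induced on [A]. *)
Definition connected_fset E A : Prop :=
  forall x y, x \in A -> y \in A ->
    exists p, [/\ path E x p, last x p = y & {subset p <= A}].

Definition srw_prob (R : realType) E x y : R :=
  if E x y then (deg E x)%:R^-1 else 0.

End Graph.

Section Walk.
Context {V : choiceType} {R : realType} {d : measure_display}
  {Omega : measurableType d}.
Implicit Types (E : rel V) (P : probability Omega R) (X : nat -> Omega -> V).

(* Under [P], [X] is a Markov chain on [V] (with its discrete sigma-algebra)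
   started at [o], with transition probabilities [srw_prob E]. The Markov
   property is written multiplicatively, so that no conditioning on null events
   occurs. *)
Definition simple_random_walk E P X (o : V) : Prop :=
  [/\ forall n (B : set V), measurable (X n @^-1` B),
      P [set w | X 0%N w = o] = 1%E &
      forall n (x : nat -> V),
        P [set w | forall i, (i <= n.+1)%N -> X i w = x i] =
        (P [set w | forall i, (i <= n)%N -> X i w = x i] *
           (srw_prob R E (x n) (x n.+1))%:E)%E].

Definition walk_range X (n : nat) (w : Omega) : {fset V} :=
  [fset X (val i) w | i in 'I_n.+1]%fset.

Definition mean_range P X (n : nat) : \bar R :=
  ('E_P[fun w => (#|` walk_range X n w|)%:R])%E.

Definition range_prob P X (n : nat) (A : {fset V}) : R :=
  fine (P [set w | walk_range X n w = A]).

(* The convention 0 log(1/0) = 0 holds because the first factor vanishes. *)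
Definition range_entropy E P X (o : V) (n : nat) : \bar R :=
  \esum_(A in [set A : {fset V} | o \in A /\ connected_fset E A])
    (range_prob P X n A * ln (1 / range_prob P X n A))%:E.

(* [P o] is the law of the walk started at [o]. *)
Definition transient (P : V -> probability Omega R) X : Prop :=
  forall o, (0 < P o [set w | forall n, (0 < n)%N -> X n w <> o])%E.

Definition recurrent (P : V -> probability Omega R) X : Prop :=
  forall o, P o [set w | forall n, (0 < n)%N -> X n w <> o] = 0%E.

End Walk.

(* Main.v *)
(* All quantities are finite expectations over the uniform [n]-step walks of a
   [D]-regular graph. Let [q_n] be the probability of no return within [n] steps;
   the mean range size is [q_0 + ... + q_n].

   Recurrent case: if [mu A] is the probability that [A] is the cluster of [o] in
   Bernoulli site percolation with closing probability [e], then the [mu A] sum to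
   at most [1], so Gibbs' inequality bounds the entropy by
     ln (1 / (1 - e)) E|R_n| + ln (1 / e) E|boundary of R_n|.
   The mean boundary is at most [D * sum_k q_(k+1) q_(n-k)], which is
   [o(q_0 + ... + q_n)] as [q_n] tends to [0]; then let [e] tend to [0].

   Transient case: at the times [jL] look for excursions x -> y -> x whose tip
   could be a neighbour of [x] visited at no other time. Given everything but the
   tips, the range reveals independent bits, each of min-entropy
   [ln (D / (D - 1))]. A positive density of the times [jL] carry such an
   excursion: hitting probabilities are symmetric, whence past and future both
   miss some neighbour of the current vertex with probability at least of order
   [q^2], and the interference of the other excursions is a tail of the Green
   function, small for large [L]. *)

Require Import Defs.
From mathcomp Require Import all_boot all_order all_algebra.
From mathcomp Require Import finmap all_classical all_reals all_analysis.
From mathcomp Require Import measurable_realfun.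
From mathcomp Require Import zify ring lra.

Set Implicit Arguments.
Unset Strict Implicit.
Unset Printing Implicit Defensive.

Import Order.TTheory GRing.Theory Num.Theory.
Import numFieldNormedType.Exports.

Local Open Scope classical_set_scope.
Local Open Scope ring_scope.

(** * Finite walks *)

Definition nbrs {V : choiceType} (E : rel V) (x : V) : seq V :=
  fset_set [set y | E x y].

(** Combinatorial form of the hypotheses: automorphisms preserve edges instead of distances, and the
    common degree is a parameter. [vertex_transitive_graph] supplies it. *)
Record transitive_graph {V : choiceType} (E : rel V) (D : nat) : Prop := {
  tg_sym : symmetric E;
  tg_irr : irreflexive E;
  tg_fin : locally_finite E;
  tg_deg : forall x, deg E x = D;
  tg_deg_gt0 : (0 < D)%N;
  tg_aut : forall x x', exists phi : V -> V,
    [/\ bijective phi, phi x = x' & forall y z, E (phi y) (phi z) = E y z] }.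

(* [f] is applied to the whole trajectory [X_0; ...; X_n], including the start. *)
Fixpoint walk_mean {R : fieldType} {V : choiceType} (E : rel V) (n : nat)
    (x : V) (f : seq V -> R) : R :=
  if n is m.+1 then
    (deg E x)%:R^-1 *
      \sum_(y <- nbrs E x) walk_mean E m y (fun p => f (x :: p))
  else f [:: x].

Arguments walk_mean : simpl never.

Section WalkMean.
Context {R : realFieldType} {V : choiceType} {E : rel V} {D : nat}.
Hypothesis G : transitive_graph E D.
Implicit Types (f g : seq V -> R) (x y z : V) (p q : seq V).

Local Notation mean := (walk_mean E).

Lemma mem_nbrs x y : (y \in nbrs E x) = E x y.
Proof.
have Ef : finite_set [set y | E x y] by exact: (tg_fin G).
by rewrite /nbrs in_fset_set//; apply/idP/idP => [/set_mem|/mem_set].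
Qed.

Lemma nbrs_uniq x : uniq (nbrs E x).
Proof. exact: fset_uniq. Qed.

Lemma size_nbrs x : size (nbrs E x) = D.
Proof. exact: (tg_deg G). Qed.

Lemma tg_natr_gt0 : 0 < D%:R :> R.
Proof. by rewrite ltr0n; exact: (tg_deg_gt0 G). Qed.

Lemma tg_natr_neq0 : D%:R != 0 :> R.
Proof. by rewrite gt_eqF// tg_natr_gt0. Qed.

Lemma sum_nbrs_cst x (c : R) : \sum_(y <- nbrs E x) c = D%:R * c.
Proof. by rewrite big_const_seq count_predT size_nbrs iter_addr_0 mulr_natl. Qed.

Lemma sum_nbrs_eq x z (F : V -> R) :
  \sum_(y <- nbrs E x) (z == y)%:R * F y = (E x z)%:R * F z.
Proof.
rewrite -mem_nbrs; have [zx|zx] := boolP (z \in nbrs E x).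
  rewrite (bigD1_seq z)//= ?nbrs_uniq// eqxx big1 ?addr0// => y yz.
  by rewrite eq_sym (negbTE yz) mul0r.
rewrite mul0r big_seq big1// => y yx; have [zy|] := eqVneq; last by rewrite mul0r.
by rewrite zy yx in zx.
Qed.

Lemma mean0 x f : mean 0 x f = f [:: x].
Proof. by []. Qed.

Lemma meanS n x f :
  mean n.+1 x f = D%:R^-1 * \sum_(y <- nbrs E x) mean n y (fun p => f (x :: p)).
Proof. by rewrite -(tg_deg G x). Qed.

Lemma le_mean n x f g :
  (forall p, path E x p -> size p = n -> f (x :: p) <= g (x :: p)) ->
  mean n x f <= mean n x g.
Proof.
elim: n x f g => [x f g fg|n IH x f g fg]; first exact: fg.
rewrite !meanS ler_pM2l ?invr_gt0 ?tg_natr_gt0//.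
rewrite big_seq [leRHS]big_seq ler_sum// => y; rewrite mem_nbrs => Exy.
by apply: IH => p yp np; apply: fg; rewrite /= ?Exy ?np.
Qed.

Lemma eq_mean n x f g :
  (forall p, path E x p -> size p = n -> f (x :: p) = g (x :: p)) ->
  mean n x f = mean n x g.
Proof. by move=> fg; apply/le_anti/andP; split; apply: le_mean => p xp np; rewrite fg. Qed.

Lemma meanD n x f g : mean n x (fun p => f p + g p) = mean n x f + mean n x g.
Proof.
elim: n x f g => // n IH x f g; rewrite !meanS -mulrDr -big_split/=.
by congr (_ * _); apply: eq_bigr => y _; rewrite IH.
Qed.

Lemma meanZ n x f (c : R) : mean n x (fun p => c * f p) = c * mean n x f.
Proof.
elim: n x f => // n IH x f; rewrite !meanS mulrCA; congr (_ * _).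
by rewrite mulr_sumr; apply: eq_bigr => y _; rewrite IH.
Qed.

Lemma meanB n x f g : mean n x (fun p => f p - g p) = mean n x f - mean n x g.
Proof.
by rewrite -[RHS]addrC -mulN1r -meanZ -meanD; apply: eq_mean => p _ _; rewrite mulN1r addrC.
Qed.

Lemma mean_cst n x (c : R) : mean n x (fun _ => c) = c.
Proof.
elim: n x => // n IH x; rewrite meanS (eq_bigr (fun=> c))// sum_nbrs_cst.
by rewrite mulKf ?tg_natr_neq0.
Qed.

Lemma mean_sum n x I (r : seq I) (P : pred I) (F : I -> seq V -> R) :
  mean n x (fun p => \sum_(i <- r | P i) F i p) =
  \sum_(i <- r | P i) mean n x (F i).
Proof.
elim: r => [|i r IH].
  by rewrite big_nil -[RHS](mean_cst n x); apply: eq_mean => p _ _; rewrite big_nil.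
rewrite big_cons -IH; case: ifPn => Pi; last first.
  by apply: eq_mean => p _ _; rewrite big_cons (negbTE Pi).
by rewrite -meanD; apply: eq_mean => p _ _; rewrite big_cons Pi.
Qed.

Lemma mean_ge0 n x f : (forall p, 0 <= f p) -> 0 <= mean n x f.
Proof. by move=> f0; rewrite -[leLHS](mean_cst n x); apply: le_mean. Qed.

(** Markov property: the second walk starts at the endpoint of the first, and [behead] drops this
    repeated vertex. *)
Lemma mean_addn m n x f :
  mean (m + n) x f =
  mean m x (fun p => mean n (last x p) (fun q => f (p ++ behead q))).
Proof.
elim: m x f => [|m IH] x f.
  rewrite add0n mean0 /=; apply: eq_mean => p _ _ //.
rewrite addSn !meanS; congr (_ * _); apply: eq_bigr => y _; rewrite IH /=.
by apply: eq_mean => p _ _.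
Qed.

Lemma mean_rcons n x f :
  mean n.+1 x f =
  mean n x (fun p => D%:R^-1 * \sum_(y <- nbrs E (last x p)) f (rcons p y)).
Proof.
rewrite -addn1 mean_addn; apply: eq_mean => p _ _; rewrite meanS.
by congr (_ * _); apply: eq_bigr => y _; rewrite mean0 /= cats1.
Qed.

Lemma mean_take m n x f :
  (m <= n)%N -> mean n x (fun p => f (take m.+1 p)) = mean m x f.
Proof.
move=> mn; rewrite -(subnKC mn) mean_addn; apply: eq_mean => p _ pm.
rewrite -[RHS](mean_cst (n - m) (last x (x :: p))); apply: eq_mean => q _ _.
by rewrite /= take_size_cat// pm.
Qed.

(** Reversibility: by regularity all [n]-step walks have the same weight, and [E] is symmetric. The
    induction peels off the first step on one side and the last step on the other. *)
Lemma mean_rev n x z f :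
  mean n x (fun p => (last x p == z)%:R * f p) =
  mean n z (fun p => (last z p == x)%:R * f (rev p)).
Proof.
elim: n x z f => [|n IH] x z f.
  rewrite !mean0 /= eq_sym; have [->//|] := eqVneq; by rewrite !mul0r.
rewrite meanS mean_rcons.
transitivity (D%:R^-1 * \sum_(y <- nbrs E x)
    mean n z (fun p => (last z p == y)%:R * f (x :: rev p))).
  congr (_ * _); apply: eq_bigr => y _.
  by rewrite -(IH y z (fun p => f (x :: p))); apply: eq_mean.
rewrite -mean_sum -meanZ; apply: eq_mean => p zp pn; congr (_ * _).
rewrite (sum_nbrs_eq x _ (fun _ => f (x :: rev (z :: p)))) (tg_sym G).
rewrite -(sum_nbrs_eq _ _ (fun _ => f (x :: rev (z :: p)))).
apply: eq_bigr => y _; rewrite last_rcons eq_sym.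
by have [->|] := eqVneq; rewrite ?mul0r// -rev_rcons.
Qed.

Section Automorphism.
Variable phi : V -> V.
Hypotheses (phi_bij : bijective phi).
Hypothesis phiE : forall y z, E (phi y) (phi z) = E y z.

Lemma perm_nbrs_aut x : perm_eq (nbrs E (phi x)) (map phi (nbrs E x)).
Proof.
have phi_inj := bij_inj phi_bij.
apply: uniq_perm; rewrite ?map_inj_uniq ?nbrs_uniq// => y.
have [psi phiK psiK] := phi_bij.
by rewrite -(psiK y) mem_map// !mem_nbrs phiE.
Qed.

Lemma mean_aut n x f : mean n (phi x) f = mean n x (fun p => f (map phi p)).
Proof.
elim: n x f => // n IH x f; rewrite !meanS (perm_big _ (perm_nbrs_aut x)).
by rewrite big_map; congr (_ * _); apply: eq_bigr => y _; rewrite IH.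
Qed.

End Automorphism.

End WalkMean.

Lemma size_undup_rcons (T : eqType) (s : seq T) (y : T) :
  size (undup (rcons s y)) = (size (undup s) + (y \notin s))%N.
Proof.
have /perm_undup/perm_size -> : rcons s y =i y :: s by move=> z; rewrite mem_rcons.
by rewrite /=; case: ifPn => _; rewrite ?addn0 ?addn1.
Qed.

(** * Escape and hitting probabilities *)

Definition no_return_prob {R : realFieldType} {V : choiceType} (E : rel V) n x : R :=
  walk_mean E n x (fun p => (x \notin behead p)%:R).

(** The start counts here, in contrast to [no_return_prob], so the value is [0] when [x = y]. *)
Definition avoid_prob {R : realFieldType} {V : choiceType} (E : rel V) n x y : R :=
  walk_mean E n x (fun p => (y \notin p)%:R).

Definition trans_prob {R : realFieldType} {V : choiceType} (E : rel V) n x y : R :=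
  walk_mean E n x (fun p => (last x p == y)%:R).

Section Escape.
Context {R : realFieldType} {V : choiceType} {E : rel V} {D : nat}.
Hypothesis G : transitive_graph E D.
Implicit Types (f g : seq V -> R) (x y z : V) (p q : seq V).

Local Notation mean := (walk_mean E).

Local Notation no_return := (no_return_prob (R := R) E).
Local Notation avoid := (avoid_prob (R := R) E).
Local Notation trans := (trans_prob (R := R) E).

Lemma ler_indic (a b : bool) : (a -> b) -> a%:R <= b%:R :> R.
Proof. by rewrite ler_nat; case: a b => [] [] // /(_ isT). Qed.

Section Automorphism.
Variable phi : V -> V.
Hypotheses (phi_bij : bijective phi).
Hypothesis phiE : forall y z, E (phi y) (phi z) = E y z.

Lemma no_return_aut n x : no_return n (phi x) = no_return n x.
Proof.
rewrite /no_return_prob (mean_aut G phi_bij phiE); apply: (eq_mean G) => p _ _ /=.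
by rewrite mem_map//; exact: bij_inj.
Qed.

Lemma avoid_aut n x y : avoid n (phi x) (phi y) = avoid n x y.
Proof.
rewrite /avoid_prob (mean_aut G phi_bij phiE); apply: (eq_mean G) => p _ _.
by rewrite mem_map//; exact: bij_inj.
Qed.

Lemma trans_aut n x y : trans n (phi x) (phi y) = trans n x y.
Proof.
rewrite /trans_prob (mean_aut G phi_bij phiE); apply: (eq_mean G) => p _ _.
by rewrite last_map inj_eq//; exact: bij_inj.
Qed.

End Automorphism.

Lemma no_return_cst n x x' : no_return n x = no_return n x'.
Proof.
by have [phi [phi_bij <- phiE]] := tg_aut G x x'; rewrite no_return_aut.
Qed.

Lemma trans_diag_cst n x x' : trans n x x = trans n x' x'.
Proof. by have [phi [phi_bij <- phiE]] := tg_aut G x x'; rewrite trans_aut. Qed.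

Lemma no_return0 x : no_return 0 x = 1.
Proof. by []. Qed.

Lemma no_return_ge0 n x : 0 <= no_return n x.
Proof. by apply: (mean_ge0 G) => p; rewrite ler0n. Qed.

Lemma no_return_le1 n x : no_return n x <= 1.
Proof.
by rewrite -[leRHS](mean_cst G n x); apply: (le_mean G) => p _ _; rewrite lern1 leq_b1.
Qed.

Lemma no_return_le m n x : (m <= n)%N -> no_return n x <= no_return m x.
Proof.
move=> mn; rewrite [leRHS]/no_return_prob -(mean_take G x _ mn).
by apply: (le_mean G) => p _ _; apply: ler_indic; apply/contra/mem_take.
Qed.

Lemma avoid_ge0 n x y : 0 <= avoid n x y.
Proof. by apply: (mean_ge0 G) => p; rewrite ler0n. Qed.

Lemma avoid_le m n x y : (m <= n)%N -> avoid n x y <= avoid m x y.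
Proof.
move=> mn; rewrite [leRHS]/avoid_prob -(mean_take G x _ mn).
by apply: (le_mean G) => p _ _; apply: ler_indic; apply/contra/mem_take.
Qed.

Lemma trans_ge0 n x y : 0 <= trans n x y.
Proof. by apply: (mean_ge0 G) => p; rewrite ler0n. Qed.

Lemma trans0 x y : trans 0 x y = (x == y)%:R.
Proof. by []. Qed.

Lemma transS n x y :
  trans n.+1 x y = D%:R^-1 * \sum_(z <- nbrs E x) trans n z y.
Proof.
rewrite /trans_prob (meanS G); congr (_ * _); apply: eq_bigr => z _.
by apply: (eq_mean G) => p _ _.
Qed.

Lemma trans_sym n x y : trans n x y = trans n y x.
Proof.
rewrite /trans_prob; transitivity (mean n x (fun p => (last x p == y)%:R * 1 : R)).
  by apply: (eq_mean G) => p _ _; rewrite mulr1.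
by rewrite (mean_rev G); apply: (eq_mean G) => p _ _; rewrite mulr1.
Qed.

(* Decompose the event of hitting [y] at the last visit to [y]. As transition
   probabilities are symmetric and [no_return] is constant, this shows that
   hitting probabilities are symmetric. *)
Lemma avoidE m x y :
  1 - avoid m x y = \sum_(k < m.+1) trans k x y * no_return (m - k) y.
Proof.
elim: m x => [|m IH] x.
  rewrite big_ord1 trans0 no_return0 mulr1 /avoid_prob mean0 inE eq_sym.
  by case: eqVneq; rewrite ?subr0 ?subrr.
rewrite big_ord_recl trans0 subn0.
(* First-step decomposition. For [x = y] hitting is certain, and the average of [1 - avoid m z y]
   falls short of [1] by exactly the probability of no return. *)
transitivity ((x == y)%:R * no_return m.+1 y +
    D%:R^-1 * \sum_(z <- nbrs E x) (1 - avoid m z y)).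
  transitivity ((x == y)%:R * no_return m.+1 x +
    D%:R^-1 * \sum_(z <- nbrs E x) (1 - avoid m z y)); last first.
    by case: eqVneq => [->//|_]; rewrite !mul0r.
  rewrite /no_return_prob (meanS G) mulrCA -mulrDr mulr_sumr -big_split /=.
  rewrite -[1 in LHS](mean_cst G m.+1 x) /avoid_prob -(meanB G) (meanS G).
  congr (_ * _); apply: eq_bigr => z _.
  have -> : 1 - avoid m z y = mean m z (fun p => 1 - (y \notin p)%:R).
    by rewrite (meanB G) (mean_cst G).
  rewrite -(meanZ G) -(meanD G).
  apply: (eq_mean G) => p _ _; rewrite in_cons negb_or (eq_sym y x).
  by case: eqVneq => [->|_] /=; ring.
congr (_ + _); rewrite mulr_sumr.
rewrite (eq_bigr (fun i : 'I_m.+1 => D%:R^-1 * \sum_(z <- nbrs E x)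
    trans i z y * no_return (m - i) y)); last first.
  by move=> i _; rewrite lift0 subSS transS -mulrA mulr_suml.
rewrite -!mulr_sumr exchange_big /=; congr (_ * _).
by apply: eq_bigr => z _; rewrite IH.
Qed.

Lemma avoid_sym m x y : avoid m x y = avoid m y x.
Proof.
apply: oppr_inj; apply: (addrI 1); rewrite !avoidE.
by apply: eq_bigr => k _; rewrite trans_sym; congr (_ * _); apply: no_return_cst.
Qed.

(** At [y = x] the left side of [avoidE] is [1], and each [no_return (m - k)] is at least
    [no_return m]. A positive escape probability thus bounds the Green function. *)
Lemma green_le m x : (\sum_(k < m.+1) trans k x x) * no_return m x <= 1.
Proof.
have <- : 1 - avoid m x x = 1.
  rewrite /avoid_prob -[RHS]subr0; congr (_ - _); apply: etrans (mean_cst G m x 0).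
  by apply: (eq_mean G) => p _ _; rewrite in_cons eqxx.
rewrite avoidE mulr_suml ler_sum// => k _.
by rewrite ler_wpM2l ?trans_ge0 ?no_return_le ?leq_subr.
Qed.

(** Not returning within [m.+1] steps means that the walk from the first neighbour [y] misses [x];
    [avoid_sym] exchanges the two vertices. *)
Lemma sum_avoid m x :
  \sum_(y <- nbrs E x) avoid m x y = D%:R * no_return m.+1 x.
Proof.
rewrite /no_return_prob (meanS G) mulVKf ?(tg_natr_neq0 G)//.
by apply: eq_bigr => y _; rewrite avoid_sym.
Qed.

(** Each vertex is counted at its last visit: the start contributes when it is never revisited, and
    what follows is a walk with one step less. *)
Lemma mean_range_size n x :
  mean n x (fun p => (size (undup p))%:R) = \sum_(k < n.+1) no_return k x.
Proof.
elim: n x => [|n IH] x; first by rewrite big_ord1 no_return0 mean0.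
rewrite big_ord_recr /= -IH addrC.
transitivity (mean n.+1 x
    (fun p => (x \notin behead p)%:R + (size (undup (behead p)))%:R : R)).
  apply: (eq_mean G) => p _ _ /=; case: ifPn => _; first by rewrite add0r.
  by rewrite -natr1 addrC.
rewrite (meanD G); congr (_ + _); rewrite (meanS G).
rewrite (eq_bigr (fun=> mean n x (fun p => (size (undup p))%:R : R))); last first.
  move=> y _; rewrite !IH; apply: eq_bigr => k _; exact: no_return_cst.
by rewrite (sum_nbrs_cst G) mulKf// (tg_natr_neq0 G).
Qed.

(* Counting new points from either end of the walk shows that the [n+1]-st step
   reaches a new vertex with the same probability that the walk does not return. *)
Lemma mean_fresh n x :
  mean n x (fun p => \sum_(y <- nbrs E (last x p)) (y \notin p)%:R) =
  D%:R * no_return n.+1 x.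
Proof.
have := mean_range_size n.+1 x; rewrite big_ord_recr /= -mean_range_size.
rewrite (mean_rcons G) => h.
have {h} : mean n x (fun p => D%:R^-1 *
      \sum_(y <- nbrs E (last x p)) (y \notin p)%:R) = no_return n.+1 x.
  apply: (addrI (mean n x (fun p => (size (undup p))%:R))).
  rewrite -h -(meanD G); apply: (eq_mean G) => p _ _.
  rewrite -{1}[(size _)%:R](mulKf (tg_natr_neq0 G)) -(sum_nbrs_cst G (last x (x :: p))).
  rewrite -mulrDr -big_split; congr (_ * _); apply: eq_bigr => y _.
  by rewrite size_undup_rcons natrD.
by rewrite (meanZ G) => <-; rewrite mulVKf// (tg_natr_neq0 G).
Qed.

End Escape.

(** * Entropy of the range *)

Fixpoint walks {V : choiceType} (E : rel V) n x : seq (seq V) :=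
  if n is m.+1 then [seq x :: p | y <- nbrs E x, p <- walks E m y] else [:: [:: x]].

Section Walks.
Context {R : realFieldType} {V : choiceType} {E : rel V} {D : nat}.
Hypothesis G : transitive_graph E D.

Lemma walksP n x p :
  reflect (exists q, [/\ p = x :: q, path E x q & size q = n]) (p \in walks E n x).
Proof.
elim: n x p => [|n IH] x p.
  rewrite inE; apply: (iffP eqP) => [->|[q [-> _ /size0nil->]]//].
  by exists [::].
apply: (iffP allpairsPdep) => [[y [q [yx /IH[r [-> yr nr]] ->]]]|].
  by exists (y :: r); rewrite /= yr nr -(mem_nbrs G) yx.
move=> [[|y q] [-> //= /andP[Exy yq] [nq]]].
by exists y, (y :: q); rewrite (mem_nbrs G); split=> //; apply/IH; exists q.
Qed.

Lemma walks_uniq n x : uniq (walks E n x).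
Proof.
elim: n x => // n IH x; apply: allpairs_uniq_dep => //; first exact: nbrs_uniq.
move=> [y p] [z q] /= /allpairsPdep[y1 [p1 [y1x /walksP[r [-> _ _]] [-> ->]]]].
move=> /allpairsPdep[z1 [q1 [z1x /walksP[r' [-> _ _]] [-> ->]]]].
by move=> [-> ->].
Qed.

Lemma mean_walks n x (f : seq V -> R) :
  walk_mean E n x f = D%:R^-1 ^+ n * \sum_(p <- walks E n x) f p.
Proof.
elim: n x f => [|n IH] x f; first by rewrite mean0 big_seq1 mul1r.
rewrite (meanS G) /= big_allpairs_dep exprS -mulrA; congr (_ * _).
by rewrite mulr_sumr; apply: eq_bigr => y _; rewrite IH.
Qed.

End Walks.

Lemma sum_uniq_eq (R : pzRingType) (T : eqType) (r : seq T) (a : T) (F : T -> R) :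
  uniq r -> a \in r -> \sum_(b <- r) (a == b)%:R * F b = F a.
Proof.
move=> ur ar; rewrite (bigD1_seq a)//= eqxx mul1r big1 ?addr0// => b ba.
by rewrite eq_sym (negbTE ba) mul0r.
Qed.

Definition vertices {V : choiceType} (p : seq V) : {fset V} := [fset v in p]%fset.

Definition ranges {V : choiceType} (E : rel V) n x : seq {fset V} :=
  undup (map vertices (walks E n x)).

Definition range_law {R : realType} {V : choiceType} (E : rel V) n x
    (A : {fset V}) : R :=
  walk_mean E n x (fun p => (vertices p == A)%:R).

Definition range_ent {R : realType} {V : choiceType} (E : rel V) n x : R :=
  \sum_(A <- ranges E n x) range_law E n x A * ln (1 / range_law E n x A).

Section RangeEntropy.
Context {R : realType} {V : choiceType} {E : rel V} {D : nat}.
Hypothesis G : transitive_graph E D.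

Local Notation mean := (walk_mean E).

Lemma mean_vertices n x (g : {fset V} -> R) :
  mean n x (fun p => g (vertices p)) = \sum_(A <- ranges E n x) range_law E n x A * g A.
Proof.
transitivity (mean n x
    (fun p => \sum_(A <- ranges E n x) g A * (vertices p == A)%:R)).
  apply: (eq_mean G) => p xp pn; rewrite -[LHS](@sum_uniq_eq _ _ (ranges E n x)).
  - by apply: eq_bigr => A _; rewrite mulrC.
  - exact: undup_uniq.
  - by rewrite mem_undup map_f//; apply/(walksP G); exists p.
rewrite (mean_sum G); apply: eq_bigr => A _.
by rewrite (meanZ G) mulrC.
Qed.

Lemma range_law_ge0 n x A : 0 <= range_law E n x A :> R.
Proof. by apply: (mean_ge0 G) => p; rewrite ler0n. Qed.

Lemma sum_range_law n x : \sum_(A <- ranges E n x) range_law E n x A = 1 :> R.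
Proof.
rewrite -[RHS](mean_cst G n x) (mean_vertices n x (fun=> 1)).
by apply: eq_bigr => A _; rewrite mulr1.
Qed.

Lemma range_law_gt0 n x A : A \in ranges E n x -> 0 < range_law E n x A :> R.
Proof.
rewrite mem_undup => /mapP[p pw ->]; rewrite /range_law (mean_walks G).
rewrite mulr_gt0 ?exprn_gt0 ?invr_gt0 ?(tg_natr_gt0 G)//.
rewrite (bigD1_seq p)//= ?(walks_uniq G)// eqxx ltr_wpDr//.
by apply: sumr_ge0 => q _; rewrite ler0n.
Qed.

Lemma ln_le_sub1 (u : R) : 0 < u -> ln u <= u - 1.
Proof.
move=> u0; have := @le_ln1Dx R (u - 1); rewrite [1 + _]addrC subrK; apply.
by rewrite ltrBrDl subrr.
Qed.

(** Gibbs' inequality for a sub-probability [mu]: by [ln u <= u - 1], with [u] the ratio of [mu] to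
    the law of the range, the difference of the two sides is at most the mass of [mu] minus [1]. *)
Lemma range_ent_gibbs n x (mu : {fset V} -> R) :
  (forall A, A \in ranges E n x -> 0 < mu A) ->
  \sum_(A <- ranges E n x) mu A <= 1 ->
  range_ent E n x <= mean n x (fun p => - ln (mu (vertices p))).
Proof.
move=> mu0 mu1; rewrite (mean_vertices n x (fun A => - ln (mu A))) -subr_le0.
rewrite /range_ent -sumrB; apply: (@le_trans _ _ (\sum_(A <- ranges E n x) (mu A - range_law E n x A))).
  rewrite big_seq [leRHS]big_seq; apply: ler_sum => A Ar.
  have L0 := range_law_gt0 Ar; have m0 := mu0 _ Ar.
  rewrite -mulrBr opprK addrC mul1r lnV ?posrE// -ln_div ?posrE//.
  apply: (@le_trans _ _ (range_law E n x A * (mu A / range_law E n x A - 1))).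
    by rewrite ler_pM2l// ln_le_sub1// divr_gt0.
  by rewrite mulrBr mulr1 mulrCA divff ?mulr1// gt_eqF.
by rewrite sumrB sum_range_law subr_le0.
Qed.

(** Apply [ln u <= u - 1] to [u = range_law E n x A * expR (g p)], with [A] the range of [p]. The
    mean of [u] is at most [1]: it averages the left side of the hypothesis over the law of [A]. *)
Lemma range_ent_ge n x (g : seq V -> R) :
  (forall A, mean n x (fun p => (vertices p == A)%:R * expR (g p)) <= 1) ->
  mean n x g <= range_ent E n x.
Proof.
move=> g1; rewrite /range_ent.
rewrite -(mean_vertices n x (fun A => ln (1 / range_law E n x A))) -subr_le0 -(meanB G).
apply: (@le_trans _ _ (mean n x
    (fun p => range_law E n x (vertices p) * expR (g p) - 1))).
  apply: (le_mean G) => p xp pn.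
  have L0 : 0 < range_law E n x (vertices (x :: p)) :> R.
    apply: range_law_gt0; rewrite mem_undup map_f//.
    by apply/(walksP G); exists p.
  apply: le_trans (ln_le_sub1 _); last by rewrite mulr_gt0 ?expR_gt0.
  by rewrite lnM ?posrE ?expR_gt0// expRK mul1r lnV ?posrE// opprK addrC.
rewrite (meanB G) (mean_cst G) subr_le0 -[leRHS](sum_range_law n x).
rewrite (_ : mean n x _ = \sum_(A <- ranges E n x) range_law E n x A *
    mean n x (fun p => (vertices p == A)%:R * expR (g p))).
  by apply: ler_sum => A _; rewrite ler_piMr ?range_law_ge0.
under eq_bigr do rewrite -(meanZ G).
rewrite -(mean_sum G); apply: (eq_mean G) => p xp pn.
under eq_bigr do rewrite mulrCA.
rewrite sum_uniq_eq ?undup_uniq// mem_undup map_f//.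
by apply/(walksP G); exists p.
Qed.

End RangeEntropy.

(** * Site percolation and the upper bound *)

(* The summands are the probabilities of pairwise disjoint cylinder events
   (open on [A i], closed on [B i]) when each site is closed with probability
   [e]; the induction conditions on the state of one site at a time. *)
Lemma sum_cylinder_le1 (R : realDomainType) (T I : eqType) (e : R) (r : seq I)
    (u : seq T) (A B : I -> pred T) :
  0 <= e <= 1 -> uniq r ->
  (forall i j, i \in r -> j \in r -> i != j ->
    exists2 t, t \in u & (A i t && B j t) || (B i t && A j t)) ->
  \sum_(i <- r) \prod_(t <- u) ((1 - e) * (~~ B i t)%:R + e * (~~ A i t)%:R) <= 1.
Proof.
move=> /andP[e0 e1]; elim: u r => [|t u IH] r r_uniq conf.
  (* With no site left two distinct indices cannot conflict, so at most one summand, an empty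
     product, remains. *)
  case: r r_uniq conf => [_ _|i [_ _|j r]]; first by rewrite big_nil.
    by rewrite big_seq1 big_nil.
  rewrite /= in_cons negb_or => /andP[/andP[ij _] _] /(_ i j).
  by rewrite !inE !eqxx orbT => /(_ isT isT ij)[].
pose W i := \prod_(t <- u) ((1 - e) * (~~ B i t)%:R + e * (~~ A i t)%:R).
(* [C = B] selects the events compatible with [t] open, [C = A] those compatible with [t] closed.
   Two selected events do not conflict at [t], hence do so in [u]. *)
have part (C : I -> pred T) : C = A \/ C = B ->
    \sum_(i <- r | ~~ C i t) W i <= 1.
  move=> CAB; rewrite -big_filter; apply: IH; first exact: filter_uniq.
  move=> i j; rewrite !mem_filter => /andP[Ci ir] /andP[Cj jr] ij.
  have [s] := conf i j ir jr ij; rewrite in_cons => /orP[/eqP ->|]; last by exists s.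
  by case: CAB Ci Cj => -> /negbTE -> /negbTE ->; rewrite ?andbF.
rewrite (eq_bigr (fun i => (1 - e) * ((~~ B i t)%:R * W i) +
    e * ((~~ A i t)%:R * W i))); last first.
  by move=> i _; rewrite big_cons mulrDl !mulrA.
rewrite big_split /= -!mulr_sumr.
have cond (C : I -> pred T) :
    \sum_(i <- r) (~~ C i t)%:R * W i = \sum_(i <- r | ~~ C i t) W i.
  rewrite [RHS]big_mkcond; apply: eq_bigr => i _.
  by case: ifP; rewrite ?mul1r ?mul0r.
rewrite !cond -[leRHS](subrK e); apply: lerD.
  by rewrite -[leRHS]mulr1 ler_wpM2l ?subr_ge0// part//; right.
by rewrite -[leRHS]mulr1 ler_wpM2l// part//; left.
Qed.

Section UpperBound.
Context {R : realType} {V : choiceType} {E : rel V} {D : nat}.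
Hypothesis G : transitive_graph E D.

Local Notation no_return := (no_return_prob (R := R) E).

Local Notation mean := (walk_mean E).

Definition outer_boundary (A : {fset V}) : {fset V} :=
  [fset y in [seq y <- flatten [seq nbrs E v | v <- A] | y \notin A]]%fset.

Lemma outer_boundaryP (A : {fset V}) y :
  reflect (y \notin A /\ exists2 v, v \in A & E v y) (y \in outer_boundary A).
Proof.
rewrite in_fset /= mem_filter; apply: (iffP andP) => -[yA].
  by move=> /flatten_mapP[v vA]; rewrite (mem_nbrs G) => vy; split=> //; exists v.
by move=> [v vA vy]; split=> //; apply/flatten_mapP; exists v; rewrite ?(mem_nbrs G).
Qed.

Lemma card_outer_boundary (A : {fset V}) :
  (#|` outer_boundary A| <= \sum_(v <- A) \sum_(y <- nbrs E v) (y \notin A))%N.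
Proof.
rewrite card_fseq (leq_trans (size_undup _))// size_filter -sum1_count.
rewrite big_flatten /= big_map leq_eqVlt; apply/orP; left; apply/eqP.
by apply: eq_bigr => v _; rewrite big_mkcond; apply: eq_bigr => y _; case: ifP.
Qed.

Lemma path_leaves x p (B : {fset V}) : path E x p -> x \in B ->
  ~~ all (mem B) p -> exists2 t, t \in p & t \in outer_boundary B.
Proof.
elim: p x => //= y p IH x /andP[xy yp] xB.
have [yB|yB _] := boolP (y \in B).
  by move=> /(IH y yp yB)[t tp tB]; exists t; rewrite // in_cons tp orbT.
by exists y; rewrite ?mem_head//; apply/outer_boundaryP; split=> //; exists x.
Qed.

Lemma mem_vertices (p : seq V) t : (t \in vertices p) = (t \in p).
Proof. by rewrite in_fset. Qed.

(** Both walks start at [x]. If their ranges differ, one walk leaves the range of the other, and it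
    first does so at a vertex of the outer boundary. This makes the cluster events disjoint. *)
Lemma ranges_conflict n x (A B : {fset V}) :
  A \in ranges E n x -> B \in ranges E n x -> A != B ->
  exists t, (t \in A) && (t \in outer_boundary B) ||
            (t \in outer_boundary A) && (t \in B).
Proof.
rewrite !mem_undup => /mapP[_ /(walksP G)[p [-> xp _]] ->].
move=> /mapP[_ /(walksP G)[q [-> xq _]] ->] pq.
have [pB|pB] := boolP (all (mem (vertices (x :: q))) p); last first.
  have [|t tp tB] := path_leaves xp _ pB; first by rewrite mem_vertices mem_head.
  by exists t; rewrite tB mem_vertices in_cons tp orbT.
have [qA|qA] := boolP (all (mem (vertices (x :: p))) q); last first.
  have [|t tq tA] := path_leaves xq _ qA; first by rewrite mem_vertices mem_head.
  by exists t; rewrite tA !mem_vertices !in_cons tq !orbT.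
case/eqP: pq; apply/fsetP => t; rewrite !mem_vertices !in_cons.
have [//|/negbTE tx] := eqVneq t x; apply/idP/idP => /=.
  by move=> /(allP pB); rewrite /= mem_vertices in_cons tx.
by move=> /(allP qA); rewrite /= mem_vertices in_cons tx.
Qed.
Section Percolation.
Variable e : R.
Hypothesis e01 : 0 < e < 1.

(* Probability that [A] is the cluster of a vertex of [A] in Bernoulli site
   percolation with closing probability [e]. *)
Definition cluster_law (A : {fset V}) : R :=
  (1 - e) ^+ #|` A| * e ^+ #|` outer_boundary A|.

(** Puts all cluster probabilities over one common list of sites, as [sum_cylinder_le1] requires; a
    site outside [A] and its boundary contributes the factor [(1 - e) + e]. *)
Lemma cluster_lawE (A : {fset V}) (u : seq V) : uniq u ->
  {subset A <= u} -> {subset outer_boundary A <= u} ->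
  cluster_law A = \prod_(t <- u)
    ((1 - e) * (t \notin outer_boundary A)%:R + e * (t \notin A)%:R).
Proof.
move=> u_uniq Au bAu.
have cnt (B : {fset V}) : {subset B <= u} -> count (mem B) u = #|` B|.
  move=> Bu; rewrite -size_filter; apply: perm_size; apply: uniq_perm.
  - exact: filter_uniq.
  - exact: fset_uniq.
  - by move=> t; rewrite mem_filter /=; apply: andb_idr => /Bu.
rewrite (bigID (mem A)) /=; congr (_ * _).
  rewrite (eq_bigr (fun=> 1 - e)); last first.
    move=> t tA; rewrite tA mulr0 addr0; case: outer_boundaryP => [[]|].
      by rewrite tA.
    by rewrite mulr1.
  by rewrite big_const_seq iter_mulr_1 cnt.
rewrite (eq_bigr (fun t => if t \in outer_boundary A then e else 1)); last first.
  by move=> t ->; case: ifP => _ /=; ring.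
rewrite -big_mkcondr /= (eq_bigl (mem (outer_boundary A))); last first.
  by move=> t /=; apply: andb_idl => /outer_boundaryP[].
by rewrite big_const_seq iter_mulr_1 cnt.
Qed.

Lemma sum_cluster_law n x : \sum_(A <- ranges E n x) cluster_law A <= 1.
Proof.
set r := ranges E n x.
pose h (A : {fset V}) : seq V := enum_fset A ++ enum_fset (outer_boundary A).
pose u := undup (flatten (map h r)).
have inu (A : {fset V}) t : A \in r -> (t \in A) || (t \in outer_boundary A) -> t \in u.
  move=> Ar At; rewrite mem_undup; apply/flattenP; exists (h A).
    exact: (map_f h).
  by rewrite mem_cat.
have /andP[e0 e1] := e01.
rewrite big_seq (eq_bigr (fun A : {fset V} => \prod_(t <- u)
    ((1 - e) * (t \notin outer_boundary A)%:R + e * (t \notin A)%:R))).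
  rewrite -big_seq; apply: (@sum_cylinder_le1 _ _ _ e r u
    (fun A t => t \in A) (fun A t => t \in outer_boundary A)).
  - by rewrite !ltW.
  - exact: undup_uniq.
  - move=> A B Ar Br AB; have [t tAB] := ranges_conflict Ar Br AB.
    exists t => //; case/orP: tAB => /andP[tA tB].
      by apply: (inu A) => //; rewrite tA.
    by apply: (inu A) => //; rewrite tA orbT.
move=> A Ar; apply: cluster_lawE; first exact: undup_uniq.
  by move=> t tA; apply: (inu A) => //; rewrite tA.
by move=> t tA; apply: (inu A) => //; rewrite tA orbT.
Qed.

End Percolation.

(** [undup] keeps the last occurrence of each entry. *)
Lemma sum_undup_last (T : eqType) (s : seq T) (x0 : T) (F : T -> R) :
  \sum_(v <- undup s) F v =
  \sum_(k < size s) (nth x0 s k \notin drop k.+1 s)%:R * F (nth x0 s k).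
Proof.
elim: s => [|a s IH]; first by rewrite big_nil big_ord0.
rewrite big_ord_recl /= drop0 -IH.
by case: ifPn => _; rewrite ?big_cons ?mul0r ?mul1r ?add0r.
Qed.

(* A visited [v] is counted at its last visit: the future does not return to [v],
   and the neighbour [y] is at least missed by the past. *)
Lemma mean_outer_boundary n x :
  mean n x (fun p => (#|` outer_boundary (vertices p)|)%:R) <=
  D%:R * \sum_(k < n.+1) no_return k.+1 x * no_return (n - k) x.
Proof.
pose h k (p : seq V) : R := (nth x p k \notin drop k.+1 p)%:R *
  \sum_(y <- nbrs E (nth x p k)) (y \notin take k.+1 p)%:R.
apply: (@le_trans _ _ (mean n x (fun p => \sum_(k < n.+1) h k p))).
  apply: (le_mean G) => p xp pn; set s := x :: p.
  apply: (@le_trans _ _ (\sum_(v <- undup s) \sum_(y <- nbrs E v) (y \notin s)%:R)).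
    rewrite (le_trans (_ : _ <= (\sum_(v <- vertices s) \sum_(y <- nbrs E v) (y \notin vertices s))%:R))//.
      by rewrite ler_nat card_outer_boundary.
    rewrite natr_sum (perm_big (undup s)); last first.
      by apply: uniq_perm; rewrite ?fset_uniq ?undup_uniq// => t; rewrite mem_vertices mem_undup.
    apply: ler_sum => v _; rewrite natr_sum; apply: ler_sum => y _.
    by rewrite mem_vertices.
  rewrite (sum_undup_last _ x) /= pn; apply: ler_sum => k _.
  apply: ler_wpM2l => //; apply: ler_sum => y _.
  by apply: ler_indic; apply/contra/mem_take.
rewrite (mean_sum G) mulr_sumr; apply: ler_sum => k _.
have kn : (k <= n)%N by rewrite -ltnS.
(* Split at time [k]: the past yields [D * no_return k.+1] by [mean_fresh], and the future yields
   [no_return (n - k)] whatever its starting vertex. *)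
rewrite -[X in mean X _ _](subnKC kn) (mean_addn G).
rewrite le_eqVlt; apply/orP; left; apply/eqP.
rewrite mulrA -(mean_fresh G) mulrC -(meanZ G); apply: (eq_mean G) => p xp pk.
rewrite (no_return_cst G _ x (last x p)) mulrC /no_return_prob -(meanZ G).
transitivity (mean (n - k) (last x p) (fun q => (\sum_(y <- nbrs E (last x p))
   (y \notin x :: p)%:R) * (last x p \notin behead q)%:R : R)); last by [].
apply: (eq_mean G) => q _ _ /=.
rewrite /h mulrC (_ : nth x _ k = last x p); last first.
  by rewrite -cat_cons nth_cat /= pk ltnS leqnn (last_nth x) pk.
by rewrite /= take_size_cat ?drop_size_cat.
Qed.

Lemma range_ent_upper n x (e : R) : 0 < e < 1 ->
  range_ent E n x <=
  - ln (1 - e) * \sum_(k < n.+1) no_return k x +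
  - ln e * (D%:R * \sum_(k < n.+1) no_return k.+1 x * no_return (n - k) x).
Proof.
move=> e01; have /andP[e0 e1] := e01.
have e1' : 0 < 1 - e by rewrite subr_gt0.
apply: le_trans (range_ent_gibbs G _ (sum_cluster_law e01 n x)) _.
  by move=> A _; rewrite mulr_gt0 ?exprn_gt0.
rewrite (eq_mean G (g := fun p => - ln (1 - e) * (size (undup p))%:R +
    - ln e * (#|` outer_boundary (vertices p)|)%:R)); last first.
  move=> p _ _; rewrite /cluster_law lnM ?posrE ?exprn_gt0// !lnXn//.
  rewrite opprD -!mulNrn -[_ *+ #|` vertices _|]mulr_natr.
  by rewrite -[_ *+ #|` outer_boundary _|]mulr_natr card_fseq.
rewrite (meanD G) !(meanZ G) (mean_range_size G) lerD2l.
apply: ler_wpM2l (mean_outer_boundary n x).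
by rewrite oppr_ge0 ln_le0// ltW.
Qed.

End UpperBound.

(** * Excursions and the lower bound *)

(* At time [j * L] the walk makes an excursion of length [2], and its neighbour
   [y] there is out of reach of all other excursions starting at a multiple of
   [L], and is not visited except possibly at the tip of this one. *)
Definition free_tip {V : choiceType} (E : rel V) x0 L p j y : bool :=
  [&& nth x0 p (j * L) == nth x0 p (j * L).+2, E (nth x0 p (j * L)) y,
    [forall s : 'I_(size p), (s %% L != 1)%N ==> (nth x0 p s != y)] &
    [forall i : 'I_(size p), (val i != j) ==> (i * L < size p)%N ==>
      ~~ E (nth x0 p (i * L)) y]].

(** A canonical choice of a free vertex that does not look at the tips, so that it survives their
    resampling. *)
Definition pick_tip {V : choiceType} (E : rel V) x0 L p j : option V :=
  ohead [seq y <- nbrs E (nth x0 p (j * L)) | free_tip E x0 L p j y].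

Section Resampling.
Context {R : realType} {V : choiceType} {E : rel V} {D : nat}.
Hypothesis G : transitive_graph E D.
Variable x0 : V.

Local Notation mean := (walk_mean E).

(* Average over the tip [p_(t+1)] of an excursion [p_t -> p_(t+1) -> p_(t+2) = p_t]. *)
Definition resample t (f : seq V -> R) (p : seq V) : R :=
  if nth x0 p t == nth x0 p t.+2 then
    D%:R^-1 * \sum_(a <- nbrs E (nth x0 p t)) f (set_nth x0 p t.+1 a)
  else f p.

(** Given [p_t = p_(t+2)] and everything but the tip, the tip is uniform among the neighbours of
    [p_t]. *)
Lemma mean_resample t n x f : (t.+2 <= n)%N -> mean n x f = mean n x (resample t f).
Proof.
elim: t n x f => [|t IH] [|n] x f //; last first.
  rewrite ltnS => tn; rewrite !(meanS G); congr (_ * _); apply: eq_bigr => y _.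
  by rewrite (IH _ _ _ tn); apply: (eq_mean G).
case: n => // n _; pose L y z := mean n z (fun p => f [:: x, y & p]).
pose K := D%:R^-1 * \sum_(a <- nbrs E x) L a x.
have lhs : mean n.+2 x f = D%:R^-1 * \sum_(y <- nbrs E x)
    D%:R^-1 * \sum_(z <- nbrs E y) L y z.
  by rewrite (meanS G); congr (_ * _); apply: eq_bigr => y _; rewrite (meanS G).
rewrite lhs (meanS G); congr (_ * _).
(* Resampling replaces each [L y x] by the average [K]; the corrections [K - L y x] cancel in the
   sum over the neighbours of [x]. *)
transitivity (\sum_(y <- nbrs E x) D%:R^-1 *
    (\sum_(z <- nbrs E y) L y z + (E y x)%:R * (K - L y x))).
  under [RHS]eq_bigr do rewrite mulrDr.
  rewrite big_split /= -[LHS]addr0; congr (_ + _); rewrite -mulr_sumr.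
  rewrite (eq_big_seq (fun y => K - L y x)); last first.
    by move=> y; rewrite (mem_nbrs G) (tg_sym G) => ->; rewrite mul1r.
  rewrite sumrB (sum_nbrs_cst G) /K mulVKf ?(tg_natr_neq0 G)//.
  by rewrite subrr mulr0.
apply: eq_bigr => y _; rewrite (meanS G); congr (_ * _).
rewrite -(sum_nbrs_eq G y x (fun z => K - L y z)) -big_split /=.
apply: eq_bigr => z _; have [<-|xz] := eqVneq x z.
  rewrite mul1r addrC subrK /K /L -(mean_sum G) -(meanZ G).
  by apply: (eq_mean G) => p _ _; rewrite /resample /= eqxx.
rewrite mul0r addr0; apply: (eq_mean G) => p _ _.
by rewrite /resample /= (negbTE xz).
Qed.

(* The tips are resampled one at a time, last index first; resampling the tip at
   [tau j] only affects the factor [h j]. *)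
Lemma mean_prod_le1 n x (M : nat) (tau : nat -> nat) (h : nat -> seq V -> R) :
  (forall j, (j < M)%N -> (tau j).+2 <= n)%N ->
  (forall j p, 0 <= h j p) ->
  (forall i j p a, (i < M)%N -> (j < M)%N -> i != j -> size p = n.+1 ->
    h i (set_nth x0 p (tau j).+1 a) = h i p) ->
  (forall j p, (j < M)%N -> size p = n.+1 -> resample (tau j) (h j) p <= 1) ->
  mean n x (fun p => \prod_(j < M) h j p) <= 1.
Proof.
move=> taun h0 hset hres.
suff : forall m, (m <= M)%N -> mean n x (fun p => \prod_(j < m) h j p) <= 1 by exact.
elim=> [_|m IH mM].
  rewrite -[leRHS](mean_cst G n x); apply: (le_mean G) => p _ _.
  by rewrite big_ord0.
apply: le_trans (IH (ltnW mM)); rewrite (mean_resample (t := tau m)) ?taun//.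
apply: (le_mean G) => p xp pn; set s := x :: p.
have sn : size s = n.+1 by rewrite /= pn.
clearbody s.
have P0 : 0 <= \prod_(j < m) h j s by apply: prodr_ge0 => j _.
apply: (@le_trans _ _ (\prod_(j < m) h j s * resample (tau m) (h m) s)); last first.
  by rewrite -[leRHS]mulr1 ler_wpM2l// hres.
rewrite /resample; case: ifP => _; last by rewrite big_ord_recr.
rewrite [leRHS]mulrCA [in leRHS]mulr_sumr le_eqVlt; apply/orP; left; apply/eqP; congr (_ * _).
apply: eq_bigr => a _; rewrite big_ord_recr /=; congr (_ * _).
apply: eq_bigr => j _; rewrite hset//; first exact: ltn_trans mM.
by rewrite ltn_eqF.
Qed.

Section Excursions.
Variable L : nat.
Hypothesis L2 : (2 < L)%N.
Implicit Types p : seq V.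

Lemma pick_tip_free p j y : pick_tip E x0 L p j = Some y -> free_tip E x0 L p j y.
Proof.
rewrite /pick_tip; case sE: [seq _ <- _ | _] => [//|z r] [<-].
by have : z \in z :: r := mem_head _ _; rewrite -sE mem_filter => /andP[].
Qed.

Lemma free_tip_pick p j y : free_tip E x0 L p j y -> pick_tip E x0 L p j.
Proof.
move=> fy; have : y \in [seq z <- nbrs E (nth x0 p (j * L)) | free_tip E x0 L p j z].
  by rewrite mem_filter fy (mem_nbrs G); case/and4P: fy.
by rewrite /pick_tip; case: [seq _ <- _ | _].
Qed.

(** [free_tip] reads the trajectory only at times not congruent to [1] modulo [L]; as [L > 2], this
    includes the times [i * L] and [(i * L).+2]. *)
Lemma pick_tip_set p j a i : ((j * L).+1 < size p)%N -> ((i * L).+2 < size p)%N ->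
  pick_tip E x0 L (set_nth x0 p (j * L).+1 a) i = pick_tip E x0 L p i.
Proof.
move=> jp ip; set p' := set_nth _ _ _ _.
have sz : size p' = size p by rewrite size_set_nth; apply/maxn_idPr.
have nthE s : (s %% L != 1)%N -> nth x0 p' s = nth x0 p s.
  move=> sL; rewrite nth_set_nth /=; case: eqP => // sE.
  by move: sL; rewrite sE -addn1 modnMDl modn_small// (ltn_trans _ L2).
have n0 k : nth x0 p' (k * L) = nth x0 p (k * L) by rewrite nthE// modnMl.
have n2 k : nth x0 p' (k * L).+2 = nth x0 p (k * L).+2.
  by rewrite nthE// -addn2 modnMDl modn_small.
rewrite /pick_tip n0; congr ohead; apply: eq_filter => y.
rewrite /free_tip n0 n2 sz; congr [&& _, _, _ & _].
  by apply: eq_forallb => s; case: (boolP (s %% L != 1)%N) => //= /nthE ->.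
by apply: eq_forallb => k; rewrite n0.
Qed.

(** A free [y] can only be visited at times [(i * L).+1], and for [i != j] this would make it a
    neighbour of the vertex at time [i * L]. So the range reveals whether the tip is [y]. *)
Lemma free_tip_mem x p j y : path E x p -> ((j * L).+1 < (size p).+1)%N ->
  free_tip E x0 L (x :: p) j y -> (nth x0 (x :: p) (j * L).+1 == y) = (y \in x :: p).
Proof.
move=> xp jp /and4P[_ _ /forallP nomid /forallP far].
apply/eqP/idP => [<-|]; first exact: mem_nth.
move=> /(nthP x0)[s sp sy]; have [sL|sL] := eqVneq (s %% L)%N 1%N; last first.
  by have := nomid (Ordinal sp); rewrite sL /= sy eqxx.
have sE : s = (s %/ L * L).+1 by rewrite {1}(divn_eq s L) sL addn1.
have sLs : (s %/ L < (size p).+1)%N by apply: leq_ltn_trans sp; exact: leq_div.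
have [<-|sj] := eqVneq (s %/ L)%N j; first by rewrite -sE.
have := far (Ordinal sLs); rewrite sj /= => /implyP.
have sLp : (s %/ L * L < size p)%N by rewrite -ltnS -sE.
move=> /(_ (leqW sLp)) /negP[].
by rewrite -sy [in nth _ _ s]sE; move/(pathP x0): xp => /(_ _ sLp).
Qed.

(** If the range is [A], every picked [y] must satisfy: the tip is [y] iff [y \in A]. Resampling
    gives this probability [1/D] or [1 - 1/D], and the two conditions on [lam] say that [expR lam]
    times either is at most [1]. *)
Lemma mean_excursions_le1 n x M (lam : R) (A : {fset V}) :
  (forall j, (j < M)%N -> (j * L).+2 <= n)%N ->
  expR lam <= D%:R -> expR lam * (1 - D%:R^-1) <= 1 ->
  mean n x (fun p => (vertices p == A)%:R *
    expR (lam * \sum_(j < M) (pick_tip E x0 L p j : bool)%:R)) <= 1.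
Proof.
move=> jn lam1 lam2.
pose h j p : R := if pick_tip E x0 L p j is Some y then
  expR lam * ((nth x0 p (j * L).+1 == y) == (y \in A))%:R else 1.
have h0 j p : 0 <= h j p.
  by rewrite /h; case: pick_tip => // y; rewrite mulr_ge0 ?expR_ge0.
apply: (@le_trans _ _ (mean n x (fun p => \prod_(j < M) h j p))).
  apply: (le_mean G) => p xp pn; have [vA|_] := eqVneq; last first.
    by rewrite mul0r prodr_ge0.
  rewrite mul1r mulr_sumr expR_sum; apply: ler_prod => j _; rewrite expR_ge0/=.
  rewrite /h; case pE: pick_tip => [y|]; last by rewrite mulr0 expR0.
  rewrite (free_tip_mem xp _ (pick_tip_free pE)); last first.
    by rewrite pn; apply: leqW; apply: jn.
  by rewrite -vA mem_vertices eqxx !mulr1.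
apply: (@mean_prod_le1 n x M (fun j => (j * L)%N) h) => //.
  move=> i j p a iM jM ij pn.
  rewrite /h pick_tip_set ?pn ?ltnS ?jn//; last by rewrite ltnW ?jn.
  rewrite nth_set_nth /= eqSS eqn_pmul2r; last by rewrite (ltn_trans _ L2).
  by rewrite (negbTE ij).
move=> j p jM pn; rewrite /resample.
have hE a : h j (set_nth x0 p (j * L).+1 a) =
    if pick_tip E x0 L p j is Some y then expR lam * ((a == y) == (y \in A))%:R else 1.
  rewrite /h pick_tip_set ?pn ?ltnS ?jn//; last by rewrite ltnW ?jn.
  by rewrite nth_set_nth /= eqxx.
case: ifP => [_|ne]; last first.
  rewrite /h; case pE: pick_tip => [y|//].
  by move: (pick_tip_free pE); rewrite /free_tip ne.
under eq_bigr do rewrite hE.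
case pE: pick_tip => [y|]; last first.
  by rewrite (sum_nbrs_cst G) mulr1 mulVf ?(tg_natr_neq0 G).
have /and4P[_ Ey _ _] := pick_tip_free pE.
have sumE : \sum_(a <- nbrs E (nth x0 p (j * L))) (a == y)%:R = 1 :> R.
  transitivity (\sum_(a <- nbrs E (nth x0 p (j * L))) (y == a)%:R * 1 : R).
    by apply: eq_bigr => a _; rewrite mulr1 eq_sym.
  by rewrite (sum_nbrs_eq G _ _ (fun=> 1)) Ey mulr1.
rewrite -mulr_sumr mulrCA; case: (y \in A).
  rewrite (eq_bigr (fun a => (a == y)%:R)); last by move=> a _; rewrite eqb_id.
  by rewrite sumE mulr1 ler_pdivrMr ?(tg_natr_gt0 G)// mul1r.
rewrite (eq_bigr (fun a => 1 - (a == y)%:R)); last first.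
  by move=> a _; rewrite eqbF_neg; case: eqP; rewrite ?subr0 ?subrr.
rewrite sumrB sumE (sum_nbrs_cst G) mulr1 mulrBr mulVf ?(tg_natr_neq0 G)//.
by rewrite mulr1.
Qed.

Lemma range_ent_ge_tips n x M (lam : R) :
  (forall j, (j < M)%N -> (j * L).+2 <= n)%N ->
  expR lam <= D%:R -> expR lam * (1 - D%:R^-1) <= 1 ->
  lam * \sum_(j < M) mean n x (fun p => (pick_tip E x0 L p j : bool)%:R) <=
  range_ent E n x.
Proof.
move=> jn lam1 lam2; rewrite -(mean_sum G) -(meanZ G).
by apply: (range_ent_ge G) => A; apply: mean_excursions_le1.
Qed.

End Excursions.

End Resampling.

(** * Neighbours missed by both the past and the future *)

Section TwoSided.
Context {R : realFieldType} {V : choiceType} {E : rel V} {D : nat}.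
Hypothesis G : transitive_graph E D.

Local Notation mean := (walk_mean E).
Local Notation no_return := (no_return_prob (R := R) E).
Local Notation avoid := (avoid_prob (R := R) E).
Local Notation trans := (trans_prob (R := R) E).

(* Decompose the event that a walk from [w] hits [x] at the first hit; each term
   is then read backwards in time, as a walk from [x]. *)
Lemma sum_last_exit t (w x : V) :
  \sum_(u < t.+1) mean u x (fun p => (last x p == w)%:R * (x \notin behead p)%:R) =
  1 - avoid t w x.
Proof.
under eq_bigr do rewrite (mean_rev G).
elim: t => [|t IH].
  rewrite big_ord1 /avoid_prob !mean0 /= inE [x == w]eq_sym mulr1.
  by case: eqVneq => _; rewrite ?subr0 ?subrr.
rewrite big_ord_recr /= IH.
(* The new term is the probability that [x] is first hit at time [t.+1]. *)
suff -> : mean t.+1 w (fun p => (last w p == x)%:R * (x \notin behead (rev p))%:R) =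
    avoid t w x - avoid t.+1 w x by ring.
rewrite /avoid_prob !(mean_rcons G) -(meanB G).
apply: (eq_mean G) => p _ _; rewrite -[X in X - _](mulKf (tg_natr_neq0 G)).
rewrite -(sum_nbrs_cst G (last w (w :: p))) -mulrBr -sumrB; congr (_ * _).
apply: eq_bigr => z _; rewrite last_rcons rev_rcons [behead _]/= mem_rev.
rewrite mem_rcons [in RHS]in_cons [x == z]eq_sym.
by have [_|_] := eqVneq z x; case: (x \in _) => /=; ring.
Qed.

(* Contribution to [mean_hit] of the walks which visit a neighbour of their
   endpoint for the last time at their starting point [x]. *)
Definition hit_back m u x : R := mean u x (fun p =>
  \sum_(y <- nbrs E (last x p))
    (y == x)%:R * (x \notin behead p)%:R * avoid m (last x p) y).

Lemma hit_back_cst m u x x' : hit_back m u x = hit_back m u x'.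
Proof.
have [phi [phi_bij <- phiE]] := tg_aut G x x'.
have phi_inj := bij_inj phi_bij.
rewrite [RHS]/hit_back (mean_aut G phi_bij phiE); apply: (eq_mean G) => p _ _.
rewrite last_map (perm_big _ (perm_nbrs_aut G phi_bij phiE _)) big_map.
apply: eq_bigr => y _; rewrite (inj_eq phi_inj) (avoid_aut G phi_bij phiE).
by rewrite /= mem_map.
Qed.

(** Only [y = x] contributes, so the endpoint is a neighbour [w] of [x]; the walks from [x] to [w]
    that do not return to [x] are summed over [u] by [sum_last_exit]. *)
Lemma sum_hit_back m t x :
  \sum_(u < t.+1) hit_back m u x =
  \sum_(w <- nbrs E x) avoid m w x * (1 - avoid t w x).
Proof.
under [RHS]eq_bigr do rewrite -sum_last_exit mulr_sumr.
rewrite exchange_big; apply: eq_bigr => u _ /=.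
under eq_bigr do rewrite -(meanZ G).
rewrite -(mean_sum G); apply: (eq_mean G) => p _ _.
set l := last x (x :: p).
transitivity (\sum_(y <- nbrs E l) (x == y)%:R *
  ((x \notin behead (x :: p))%:R * avoid m l y)).
  by apply: eq_bigr => y _; rewrite mulrA eq_sym.
rewrite (sum_nbrs_eq G _ _ (fun y => _ * avoid m l y)) (tg_sym G).
rewrite -(sum_nbrs_eq G _ _ (fun y => _ * avoid m y x)).
by apply: eq_bigr => y _; ring.
Qed.

(** Decompose by the last visit to [y]: either it is the start, which gives [hit_back m t.+1], or
    [y] occurs after the first step, in a walk shorter by one. *)
Lemma mean_hit m t x :
  mean t x (fun p => \sum_(y <- nbrs E (last x p))
    (y \in p)%:R * avoid m (last x p) y) =
  \sum_(u < t.+1) hit_back m u x.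
Proof.
elim: t x => [|t IH] x.
  rewrite big_ord1 /hit_back !mean0; apply: eq_bigr => y _.
  by rewrite inE mulr1.
rewrite big_ord_recr /= addrC.
transitivity (hit_back m t.+1 x + mean t.+1 x (fun p =>
    \sum_(y <- nbrs E (last x p)) (y \in behead p)%:R * avoid m (last x p) y)).
  rewrite /hit_back -(meanD G); apply: (eq_mean G) => p _ _.
  rewrite -big_split /=; apply: eq_bigr => y _; rewrite in_cons.
  by have [->|_] := eqVneq y x; case: (_ \in p) => /=; ring.
congr (_ + _); rewrite (meanS G).
rewrite (eq_bigr (fun=> \sum_(u < t.+1) hit_back m u x)).
  by rewrite (sum_nbrs_cst G) mulKf// (tg_natr_neq0 G).
move=> y _; rewrite (eq_bigr (fun u : 'I_t.+1 => hit_back m u y)); last first.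
  by move=> u _; apply: hit_back_cst.
by rewrite -IH; apply: (eq_mean G).
Qed.

(** Past and future miss a neighbour of the current vertex as if they were two independent walks
    from [x]. The proof subtracts [mean_hit] from the total given by [sum_avoid]. *)
Lemma mean_two_sided m t x :
  mean t x (fun p => \sum_(y <- nbrs E (last x p))
    (y \notin p)%:R * avoid m (last x p) y) =
  \sum_(w <- nbrs E x) avoid m x w * avoid t x w.
Proof.
transitivity (D%:R * no_return m.+1 x -
  \sum_(w <- nbrs E x) avoid m w x * (1 - avoid t w x)).
  rewrite -sum_hit_back -mean_hit -[D%:R * _](mean_cst G t x) -(meanB G).
  apply: (eq_mean G) => p _ _.
  rewrite (no_return_cst G _ x (last x (x :: p))) -(sum_avoid G) -sumrB.
  apply: eq_bigr => y _; case: (y \in _); rewrite /= ?mul0r ?mul1r ?subrr//.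
  by rewrite subr0.
rewrite -(sum_avoid G) -sumrB; apply: eq_bigr => w _.
by rewrite !(avoid_sym G _ w x); ring.
Qed.

Section EscapeBound.
Variable q : R.
Hypotheses (q0 : 0 <= q) (q_le : forall k x, q <= no_return k x).

Lemma two_sided_ge m t x :
  D%:R * q ^+ 2 <= \sum_(w <- nbrs E x) avoid m x w * avoid t x w.
Proof.
pose N := maxn m t; pose a w := avoid N x w.
(* Both factors are at least [a w]. The tangent bound [a ^+ 2 >= 2 * q * a - q ^+ 2] does the work
   of the Cauchy-Schwarz inequality, as the [a w] sum to at least [D * q]. *)
apply: (@le_trans _ _ (\sum_(w <- nbrs E x) (2 * q * a w - q ^+ 2))).
  rewrite sumrB -mulr_sumr (sum_avoid G) (sum_nbrs_cst G).
  have := q_le N.+1 x; have := tg_natr_gt0 (R := R) G; set d := D%:R.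
  set r := no_return _ _ => d0 qr.
  have : 0 <= d * q * (r - q) by rewrite mulr_ge0 ?subr_ge0// mulr_ge0// ltW.
  lra.
apply: ler_sum => w _; apply: (@le_trans _ _ (a w ^+ 2)).
  by rewrite -subr_ge0 (_ : _ - _ = (a w - q) ^+ 2) ?sqr_ge0//; ring.
by rewrite expr2 ler_pM ?(avoid_ge0 G)// (avoid_le G) ?leq_maxl ?leq_maxr.
Qed.

Lemma mean_excursion m v (g : seq V -> R) :
  mean m.+2 v (fun p => (v == nth v p 2)%:R * g (drop 2 p)) = D%:R^-1 * mean m v g.
Proof.
rewrite (meanS G); congr (_ * _).
rewrite -[RHS](mulKf (tg_natr_neq0 G)) -(sum_nbrs_cst G v) mulr_sumr.
rewrite !big_seq; apply: eq_bigr => y; rewrite (mem_nbrs G) (tg_sym G) => yv.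
rewrite (meanS G); congr (_ * _).
transitivity (\sum_(z <- nbrs E y) (v == z)%:R * mean m z g).
  apply: eq_bigr => z _; rewrite -(meanZ G); by apply: (eq_mean G).
by rewrite (sum_nbrs_eq G) yv mul1r.
Qed.

(** The excursion costs a factor [1/D], after which a fresh walk leaves from the vertex at time [t];
    [two_sided_ge] returns the factor [D]. *)
Lemma mean_good_excursion x0 n t x : (t.+2 <= n)%N ->
  q ^+ 2 <= mean n x (fun p => \sum_(y <- nbrs E (nth x0 p t))
     (nth x0 p t == nth x0 p t.+2)%:R * (y \notin take t.+1 p)%:R *
       (y \notin drop t.+2 p)%:R).
Proof.
move=> tn; have -> : n = (t + (n - t.+2).+2)%N by lia.
set m := (n - t.+2)%N; rewrite (mean_addn G).
apply: (@le_trans _ _ (mean t x (fun p => D%:R^-1 * \sum_(y <- nbrs E (last x p))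
    (y \notin p)%:R * avoid m (last x p) y))).
  rewrite (meanZ G) mean_two_sided ler_pdivlMl ?(tg_natr_gt0 G)//.
  exact: two_sided_ge.
apply: (le_mean G) => p xp pt; rewrite mulr_sumr.
set v := last x (x :: p).
rewrite le_eqVlt; apply/orP; left; apply/eqP.
transitivity (\sum_(y <- nbrs E v) mean m.+2 v (fun r =>
    (y \notin x :: p)%:R * ((v == nth v r 2)%:R * (y \notin drop 2 r)%:R : R))).
  apply: eq_bigr => y _.
  by rewrite (meanZ G) (mean_excursion _ _ (fun r => (y \notin r)%:R)) mulrCA.
rewrite -(mean_sum G); apply: (eq_mean G) => r vr rm.
have nt : nth x0 ((x :: p) ++ behead (v :: r)) t = v.
  by rewrite nth_cat /= pt leqnn -pt (nth_last x0 (x :: p)).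
have nt2 : nth x0 ((x :: p) ++ behead (v :: r)) t.+2 = nth v (v :: r) 2.
  rewrite nth_cat [size _]/= pt; have -> : (t.+2 < t.+1)%N = false by lia.
  have -> : (t.+2 - t.+1 = 1)%N by lia.
  by rewrite /=; apply: set_nth_default; rewrite rm.
have -> : drop t.+2 ((x :: p) ++ behead (v :: r)) = drop 2 (v :: r).
  rewrite drop_cat [size _]/= pt; have -> : (t.+2 < t.+1)%N = false by lia.
  by have -> : (t.+2 - t.+1 = 1)%N by lia.
rewrite nt nt2 take_size_cat ?pt//; last by rewrite /= pt.
by apply: eq_bigr => y _; ring.
Qed.

End EscapeBound.

Lemma sum_nbrs_common v w :
  \sum_(y <- nbrs E v) (E w y)%:R = D%:R ^+ 2 * trans 2 v w.
Proof.
rewrite (transS G) expr2 -mulrA (mulVKf (tg_natr_neq0 G)) mulr_sumr.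
apply: eq_bigr => y _; rewrite (transS G) (mulVKf (tg_natr_neq0 G)).
transitivity (\sum_(z <- nbrs E y) (w == z)%:R * 1 : R).
  by rewrite (sum_nbrs_eq G) mulr1 (tg_sym G).
by apply: eq_bigr => z _; rewrite mulr1 trans0 eq_sym.
Qed.

Lemma mean_trans2 k v : mean k v (fun p => trans 2 v (last v p)) = trans (k + 2) v v.
Proof.
rewrite /trans_prob (mean_addn G); apply: (eq_mean G) => p _ _.
rewrite -/(trans _ _ _) (trans_sym G) /trans_prob; apply: (eq_mean G) => r _ _.
by rewrite last_cat.
Qed.

Lemma mean_trans_pair x0 n s t x : (s <= t <= n)%N ->
  mean n x (fun p => trans 2 (nth x0 p s) (nth x0 p t)) = trans (t - s + 2) x x.
Proof.
move=> /andP[st tn].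
transitivity (mean n x
    (fun p => trans 2 (nth x0 (take t.+1 p) s) (nth x0 (take t.+1 p) t))).
  by apply: (eq_mean G) => p _ _; rewrite !nth_take.
rewrite (mean_take G _ (fun p => trans 2 (nth x0 p s) (nth x0 p t)) tn).
rewrite -[X in mean X](subnKC st) (mean_addn G) -[RHS](mean_cst G s x).
apply: (eq_mean G) => p _ ps; rewrite (trans_diag_cst G _ x (last x (x :: p))).
rewrite -mean_trans2; apply: (eq_mean G) => r _ rs.
congr (trans 2 _ _).
  by rewrite nth_cat /= ps leqnn -ps (nth_last x0 (x :: p)).
have prt : size (p ++ r) = t by rewrite size_cat ps rs subnKC.
transitivity (last x0 (x :: p ++ r)); first by rewrite -(nth_last x0 (x :: p ++ r)) [size _]/= prt.
by rewrite last_cons last_cat.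
Qed.

End TwoSided.

(** * Positive density of excursions with a free tip *)

Section TipDensity.
Context {R : realType} {V : choiceType} {E : rel V} {D : nat}.
Hypothesis G : transitive_graph E D.

Local Notation mean := (walk_mean E).
Local Notation no_return := (no_return_prob (R := R) E).
Local Notation trans := (trans_prob (R := R) E).

Variables (q tau : R) (L : nat) (x0 : V).
Hypotheses (q0 : 0 <= q) (q_le : forall k x, q <= no_return k x).
Hypothesis L2 : (2 < L)%N.
Hypothesis tail : forall N x, \sum_(L <= s < N) trans s x x <= tau.

(** As [L > 2], the times [k.+1 * L + 2] lie in disjoint consecutive blocks of length [L], all
    beyond [L]. *)
Lemma sum_trans_multiples K x :
  \sum_(0 <= k < K) trans (k.+1 * L + 2) x x <= tau.
Proof.
apply: le_trans (tail (K.+1 * L) x).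
elim: K => [|K IH]; first by rewrite big_nil mul1n big_geq.
rewrite big_nat_recr //= [leRHS](big_cat_nat (n := K.+1 * L)%N) /=; try by lia.
apply: lerD => //.
rewrite (big_cat_nat (n := (K.+1 * L + 2)%N)) /=; try by lia.
rewrite [X in _ + X]big_ltn; last by lia.
by rewrite addrCA lerDl addr_ge0// sumr_ge0// => i _; exact: (trans_ge0 G).
Qed.

(** The common neighbours of the vertices at times [i * L] and [j * L] number [D ^+ 2] times a
    two-step transition probability, with mean a return probability at time [|i - j| * L + 2]. The
    indices below and above [j] contribute at most [tau] each. *)
Lemma mean_common_le n j x : (j * L <= n)%N ->
  mean n x (fun p => \sum_(i < n.+1 | (val i != j) && (i * L < n.+1)%N)
    \sum_(y <- nbrs E (nth x0 p (j * L))) (E (nth x0 p (i * L)) y)%:R) <=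
  D%:R ^+ 2 * (2 * tau).
Proof.
move=> jn; rewrite (mean_sum G).
pose F i : R := if (i < j)%N then trans ((j - i) * L + 2) x x
  else trans ((i - j) * L + 2) x x.
have F0 i : 0 <= F i by rewrite /F; case: ifP => _; exact: (trans_ge0 G).
apply: (@le_trans _ _ (\sum_(i < n.+1 | val i != j) D%:R ^+ 2 * F i)).
  rewrite [leRHS](bigID (fun i : 'I_n.+1 => i * L < n.+1)%N) /= ler_wpDr//.
    by apply: sumr_ge0 => i _; rewrite mulr_ge0// exprn_ge0.
  apply: ler_sum => i /andP[ij iL]; rewrite le_eqVlt; apply/orP; left; apply/eqP.
  rewrite (eq_mean G (g := fun p => D%:R ^+ 2 *
      trans 2 (nth x0 p (j * L)) (nth x0 p (i * L)))); last first.
    by move=> p _ _; rewrite (sum_nbrs_common G).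
  rewrite (meanZ G); congr (_ * _); rewrite /F; case: ltnP => ij'.
    rewrite (eq_mean G (g := fun p =>
      trans 2 (nth x0 p (i * L)) (nth x0 p (j * L)))); last first.
      by move=> p _ _; rewrite (trans_sym G).
    by rewrite (mean_trans_pair G) ?mulnBl// jn andbT leq_mul2r ltnW ?orbT.
  by rewrite (mean_trans_pair G) ?mulnBl// leq_mul2r ij' orbT -ltnS.
rewrite -mulr_sumr ler_wpM2l ?exprn_ge0//.
rewrite -(big_mkord (fun i => i != j) F).
have jn1 : (j < n.+1)%N.
  by rewrite ltnS (leq_trans _ jn)// leq_pmulr// (ltn_trans _ L2).
rewrite (big_cat_nat (n := j)) ?(ltnW jn1)//=.
rewrite [X in _ + X]big_ltn_cond// eqxx mulr2n mulrDl mul1r; apply: lerD.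
  apply: le_trans (sum_trans_multiples j x).
  rewrite big_nat_rev big_mkcond /= big_nat [leRHS]big_nat.
  apply: ler_sum => i ij; rewrite /F; case: ifP => _; last exact: (trans_ge0 G).
  have -> : (0 + j - i.+1 < j)%N by lia.
  by have -> : (j - (0 + j - i.+1) = i.+1)%N by lia.
apply: le_trans (sum_trans_multiples (n - j) x).
rewrite -{1}[j.+1]add0n big_addn subSS big_mkcond /= big_nat [leRHS]big_nat.
apply: ler_sum => i ij; rewrite /F; case: ifP => _; last exact: (trans_ge0 G).
have -> : (i + j.+1 < j)%N = false by lia.
by have -> : (i + j.+1 - j = i.+1)%N by lia.
Qed.

(** A neighbour missed before and after the excursion is free unless it is adjacent to the vertex at
    some other time [i * L]. The factor [1/D] passes from the number of free neighbours to the
    existence of one. *)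
Lemma mean_pick_tip_ge n j x : ((j * L).+2 <= n)%N ->
  D%:R^-1 * (q ^+ 2 - D%:R ^+ 2 * (2 * tau)) <=
  mean n x (fun p => (pick_tip E x0 L p j : bool)%:R).
Proof.
move=> jn; set t := (j * L)%N.
apply: (@le_trans _ _ (mean n x (fun p => D%:R^-1 *
    \sum_(y <- nbrs E (nth x0 p t)) (free_tip E x0 L p j y)%:R))); last first.
  apply: (le_mean G) => p xp pn; rewrite ler_pdivrMl ?(tg_natr_gt0 G)//.
  rewrite -(sum_nbrs_cst G (nth x0 (x :: p) t)); apply: ler_sum => y _.
  by apply: ler_indic => /(free_tip_pick G).
rewrite (meanZ G) ler_wpM2l ?invr_ge0//.
apply: le_trans (lerB (mean_good_excursion G q0 q_le x0 x jn)
  (mean_common_le x (ltnW (ltnW jn)))) _.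
rewrite -(meanB G); apply: (le_mean G) => p xp pn; set s := x :: p.
rewrite exchange_big /= -sumrB big_seq [leRHS]big_seq; apply: ler_sum => y.
rewrite (mem_nbrs G) => ty; rewrite lerBlDr -!natrM -natr_sum -natrD ler_nat.
have [_|nfree] := boolP (free_tip E x0 L s j y).
  by rewrite !mulnb; case: (_ && _).
rewrite add0n !mulnb; case: andP => // -[/andP[exc yt] yd] /=.
have sn : size s = n.+1 by rewrite /= pn.
move: nfree; rewrite /free_tip exc ty !andTb negb_and => /orP[|].
  rewrite negb_forall => /existsP[[k /= ks]]; rewrite negb_imply negbK => /andP[kL].
  move=> /eqP ky; have [kt|tk] := ltnP k t.+1.
    by move: yt; rewrite -ky -(nth_take x0 kt) mem_nth// size_take sn; case: ifP => //; lia.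
  (* The time [t.+1] of the tip is excluded since it is [1] modulo [L]. *)
  have tk2 : (t.+2 <= k)%N.
    rewrite ltn_neqAle tk andbT; apply: contraNneq kL => <-.
    by rewrite -addn1 modnMDl modn_small// (ltn_trans _ L2).
  by move: yd; rewrite -ky -(subnKC tk2) -nth_drop mem_nth// size_drop sn; lia.
rewrite negb_forall => /existsP[[i /= si]]; rewrite 2!negb_imply negbK.
move=> /and3P[ij iL Ey]; have i1 : (i < n.+1)%N by rewrite -sn.
by rewrite (bigD1 (Ordinal i1)) /= ?ij -?sn ?iL// Ey.
Qed.

End TipDensity.

(** * From the Markov chain to finite walks *)

Lemma connected_vertices (V : choiceType) (E : rel V) x p :
  symmetric E -> path E x p -> connected_fset E (vertices (x :: p)).
Proof.
move=> Esym xp; pose A := vertices (x :: p).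
have from_x y : y \in A -> exists q, [/\ path E x q, last x q = y & {subset q <= A}].
  rewrite mem_vertices => yp; move: (xp); rewrite /A; case: (splitPl yp) => p1 p2 p1y.
  rewrite cat_path => /andP[xp1 _]; exists p1; split=> // z zp1.
  by rewrite mem_vertices in_cons mem_cat zp1 orbT.
have to_x y : y \in A -> exists q, [/\ path E y q, last y q = x & {subset q <= A}].
  move=> /from_x[q [xq <- qA]]; exists (rev (belast x q)); split.
  - by rewrite rev_path; under eq_path do rewrite Esym.
  - by case: q {xq qA} => //= z q; rewrite rev_cons last_rcons.
  move=> z; rewrite mem_rev => /mem_belast; rewrite in_cons => /orP[/eqP->|]; last exact: qA.
  by rewrite mem_vertices mem_head.
move=> y z /to_x[q [yq qx qA]] /from_x[r [xr rz rA]]; exists (q ++ r); split.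
- by rewrite cat_path yq qx.
- by rewrite last_cat qx.
- by move=> v; rewrite mem_cat => /orP[/qA|/rA].
Qed.

Section Trajectory.
Context {R : realType} {V : choiceType} {E : rel V} {D : nat}.
Hypothesis G : transitive_graph E D.
Context {d : measure_display} {Omega : measurableType d}.
Variables (P : probability Omega R) (X : nat -> Omega -> V) (o : V).
Hypothesis PX : simple_random_walk E P X o.

Local Notation mean := (walk_mean E).

Definition trajectory n (w : Omega) : seq V := mkseq (X ^~ w) n.+1.

Definition cylinder n (p : seq V) : set Omega := [set w | trajectory n w = p].

Lemma cylinder_nth n (x : nat -> V) :
  cylinder n (mkseq x n.+1) = [set w | forall i, (i <= n)%N -> X i w = x i].
Proof.
apply/seteqP; split => w /=.
  move=> wx i ip; have := congr1 (fun s => nth o s i) wx.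
  by rewrite !nth_mkseq ?ltnS.
by move=> wx; apply/eq_in_map => i; rewrite mem_iota add0n ltnS; exact: wx.
Qed.

Lemma measurable_preimage n (B : set V) : measurable (X n @^-1` B).
Proof. by case: PX. Qed.

Lemma measurable_cylinder n p : measurable (cylinder n p).
Proof.
have [pn|pn] := eqVneq (size p) n.+1; last first.
  rewrite (_ : cylinder n p = set0) => [|]; first exact: measurable0.
  by apply/seteqP; split => w //= wp; move: pn; rewrite -wp size_mkseq eqxx.
have -> : p = mkseq (nth o p) n.+1 by rewrite -pn mkseq_nth.
rewrite cylinder_nth (_ : [set _ | _] =
    \bigcap_(i in [set i | (i <= n)%N]) X i @^-1` [set nth o p i]); last first.
  by apply/seteqP; split.
apply: bigcap_measurableType => // i _; exact: measurable_preimage.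
Qed.

Lemma prob_cylinder n p : path E o p -> size p = n ->
  P (cylinder n (o :: p)) = (D%:R^-1 ^+ n)%:E.
Proof.
move=> op pn; have -> : o :: p = mkseq (nth o (o :: p)) n.+1.
  by rewrite -pn -[(size p).+1]/(size (o :: p)) mkseq_nth.
have [_ P0 PS] := PX; have {op} : forall i, (i < n)%N -> E (nth o (o :: p) i) (nth o (o :: p) i.+1).
  by rewrite -pn; move/(pathP o): op.
elim: n {pn} => [_|n IH step].
  rewrite cylinder_nth expr0 -P0; congr (P _); apply/seteqP; split => w /=.
    by move=> /(_ 0%N)->.
  by move=> wo i; rewrite leqn0 => /eqP ->.
rewrite cylinder_nth PS -cylinder_nth IH; last by move=> i ni; apply: step; rewrite ltnW.
by rewrite /srw_prob step// (tg_deg G) -EFinM exprSr.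
Qed.

Lemma prob_cylinders n (r : seq (seq V)) : uniq r ->
  {subset r <= walks E n o} ->
  P (\big[setU/set0]_(p <- r) cylinder n p) =
  (D%:R^-1 ^+ n * \sum_(p <- r) 1)%:E.
Proof.
elim: r => [|p r IH] /=; first by rewrite !big_nil measure0 mulr0.
move=> /andP[pr ur] sub; rewrite !big_cons measureU.
- rewrite [X in (_ + X)%E](IH ur); last first.
    by move=> q qr; apply: sub; rewrite in_cons qr orbT.
  have /(walksP G)[q [-> oq qn]] := sub _ (mem_head p r).
  by rewrite [X in (X + _)%E](prob_cylinder oq qn) -EFinD mulrDr mulr1.
- exact: measurable_cylinder.
- by apply: bigsetU_measurable => q _; exact: measurable_cylinder.
rewrite -bigcup_seq; apply/seteqP; split => w //= -[wp [q /= qr wq]].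
by move: pr; rewrite -wp wq qr.
Qed.

Lemma prob_trajectory_ge n (B : set Omega) (Q : pred (seq V)) : measurable B ->
  (forall w, Q (trajectory n w) -> B w) ->
  ((mean n o (fun p => (Q p)%:R))%:E <= P B)%E.
Proof.
move=> mB QB; rewrite (mean_walks G).
rewrite (_ : \sum_(p <- walks E n o) (Q p)%:R =
    \sum_(p <- [seq p <- walks E n o | Q p]) 1 :> R); last first.
  by rewrite big_filter [RHS]big_mkcond; apply: eq_bigr => p _; case: (Q p).
rewrite -(prob_cylinders (n := n)) ?filter_uniq ?(walks_uniq G)//; last first.
  by move=> p; rewrite mem_filter => /andP[].
apply: le_measure; rewrite ?inE//.
  by apply: bigsetU_measurable => q _; exact: measurable_cylinder.
rewrite -bigcup_seq => w [p /=]; rewrite mem_filter => /andP[Qp _] wp.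
by apply: QB; rewrite wp.
Qed.

(** The lower bound is applied to [B] and to its complement; the two means add up to [1]. *)
Lemma prob_trajectory n (B : set Omega) (Q : pred (seq V)) : measurable B ->
  (forall w, B w <-> Q (trajectory n w)) ->
  P B = (mean n o (fun p => (Q p)%:R))%:E.
Proof.
move=> mB QB; apply/le_anti/andP; split; last first.
  by apply: prob_trajectory_ge => // w /QB.
have : ((mean n o (fun p => (~~ Q p)%:R))%:E <= P (~` B))%E.
  apply: (@prob_trajectory_ge n (~` B) (predC Q)); first exact: measurableC.
  by move=> w /= /negP nQ /QB.
rewrite probability_setC// -(fineK (fin_num_measure P B mB)) -EFinB !lee_fin.
rewrite (eq_mean G (g := fun p => 1 - (Q p)%:R)); last first.
  by move=> p _ _; case: (Q _); rewrite /= ?subrr ?subr0.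
by rewrite (meanB G) (mean_cst G) lerBlDr addrAC lerBrDr lerD2l.
Qed.

Lemma walk_rangeE n w : walk_range X n w = vertices (trajectory n w).
Proof.
apply/fsetP => v; rewrite mem_vertices; apply/imfsetP/mapP.
  by move=> [i _ ->]; exists (val i); rewrite // mem_iota ltn_ord.
move=> [i]; rewrite mem_iota add0n => /andP[_ ip] ->.
by exists (Ordinal ip).
Qed.

Lemma range_probE n A : range_prob P X n A = range_law E n o A.
Proof.
rewrite /range_prob /range_law (@prob_trajectory n _ (fun p => vertices p == A))//.
(* For measurability: all positions lie in [A], and each of its finitely many points is visited. *)
- rewrite (_ : [set _ | _] = (\bigcap_(i in [set i | (i <= n)%N]) X i @^-1` [set` A]) `&`
    (\bigcap_(a in [set` A]) \bigcup_(i in [set i | (i <= n)%N]) X i @^-1` [set a])).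
    apply: measurableI.
      by apply: bigcap_measurableType => // i _; exact: measurable_preimage.
    apply: fin_bigcap_measurable => // a _; apply: bigcup_measurable => i _.
    exact: measurable_preimage.
  apply/seteqP; split => w /=.
    move=> <-; split=> [i /= ni|a /= /imfsetP[i _ ->]].
      by apply/imfsetP; exists (Ordinal (ni : (i < n.+1)%N)).
    by exists (val i) => //=; rewrite -ltnS.
  move=> [wA Aw]; apply/fsetP => v; apply/imfsetP/idP.
    by move=> [i _ ->]; apply: wA => /=; rewrite -ltnS.
  by move=> /Aw[i /= ni <-]; exists (Ordinal (ni : (i < n.+1)%N)).
- by move=> w; rewrite /= walk_rangeE; split=> /eqP.
Qed.

Lemma range_lawN n A : A \notin ranges E n o ->
  range_law E n o A = 0 :> R.
Proof.
move=> nA; rewrite /range_law (mean_walks G) big_seq big1 ?mulr0// => p pw.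
by case: eqP => // pA; move: nA; rewrite -pA mem_undup map_f.
Qed.

(** The ranges of actual walks are connected and contain [o], and the summands of all other sets
    vanish. *)
Lemma range_entropyE n : range_entropy E P X o n = (range_ent E n o)%:E.
Proof.
pose a A : \bar R :=
  (range_law E n o A * ln (1 / range_law E n o A) : R)%:E.
have a0 A : (0 <= a A)%E.
  rewrite lee_fin; have [->|L0] := eqVneq (range_law E n o A : R) 0.
    by rewrite mul0r.
  have {}L0 : 0 < range_law E n o A :> R by rewrite lt_def L0 (range_law_ge0 G).
  rewrite mulr_ge0 ?(ltW L0)// ln_ge0// mul1r invf_ge1//.
  rewrite -[leRHS](mean_cst G n o); apply: (le_mean G) => p _ _.
  by rewrite lern1 leq_b1.
transitivity (\esum_(A in [set A : {fset V} | o \in A /\ connected_fset E A]) a A).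
  by apply: eq_esum => A _; rewrite range_probE.
transitivity (\esum_(A in [set` ranges E n o]) a A).
  rewrite [RHS]esum_mkcond [LHS]esum_mkcond; apply: eq_esum => A _.
  have [Ar|Ar] := boolP (A \in ranges E n o).
    rewrite !mem_set//=; move: Ar; rewrite mem_undup => /mapP[_ /(walksP G)[p [-> op _]] ->].
    by split; [rewrite mem_vertices mem_head|exact: connected_vertices (tg_sym G) op].
  rewrite [X in _ = X]ifF; last by apply/negbTE; apply: contra Ar => /set_mem.
  by rewrite /a range_lawN// mul0r; case: ifP.
rewrite esum_fset//; first by rewrite -fsbig_seq ?undup_uniq// sumEFin.
exact: finite_seq.
Qed.

(** Holds for arbitrary functions, since the integral is a supremum over the simple functions below
    the integrand. *)
Lemma ge0_le_integralT (f g : Omega -> \bar R) :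
  (forall w, 0 <= f w)%E -> (forall w, f w <= g w)%E ->
  (\int[P]_w f w <= \int[P]_w g w)%E.
Proof.
move=> f0 fg; rewrite !ge0_integralTE//; last first.
  by move=> w; apply: le_trans (fg w).
apply: ereal_sup_le => _ [h hf <-]; exists h => // w.
by apply: le_trans (fg w).
Qed.

(* When [V] is uncountable the range size need not be measurable. Off a null set
   it is nevertheless a simple function. *)
Lemma mean_rangeE n : mean_range P X n =
  (mean n o (fun p => (size (undup p))%:R))%:E.
Proof.
pose W := walks E n o.
pose N := ~` (\big[setU/set0]_(p <- W) cylinder n p).
have mU : measurable (\big[setU/set0]_(p <- W) cylinder n p).
  by apply: bigsetU_measurable => q _; exact: measurable_cylinder.
have PN : P N = 0%E.
  rewrite probability_setC// [X in (_ - X)%E](prob_cylinders (walks_uniq G n o))//.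
  by rewrite -(mean_walks G) (mean_cst G) subee.
(* [None] stands for the null set [N], where the size is only known to be at most [n.+1]. The sum
   [g] bounds the size from below without [None] and from above with it. *)
pose c (i : option (seq V)) : R :=
  if i is Some p then (size (undup p))%:R else n.+1%:R.
pose S i := if i is Some p then cylinder n p else N.
have mS i : measurable (S i).
  by case: i => [p|]; [exact: measurable_cylinder|exact: measurableC].
pose g (r : seq (option (seq V))) w := (\sum_(i <- r) (c i * \1_(S i) w)%:E)%E.
have c0 i : 0 <= c i by case: i => *; exact: ler0n.
have intg r : (\int[P]_w g r w = (\sum_(i <- r) (c i)%:E * P (S i)))%E.
  rewrite ge0_integral_sum//; first last.
  - by move=> i w _; rewrite lee_fin mulr_ge0.
  - move=> i; apply/measurable_EFinP; apply: measurable_funM; first exact: measurable_cst.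
    exact: (measurable_indic (mS i)).
  apply: eq_bigr => i _; under eq_integral do rewrite EFinM.
  rewrite ge0_integralZl_EFin//.
  - by rewrite integral_indic// setIT.
  - by apply/measurable_EFinP; exact: measurable_indic.
have intW : (\int[P]_w g (map Some W) w)%E = (mean n o (fun p => (size (undup p))%:R))%:E.
  rewrite intg big_map (mean_walks G) mulr_sumr -sumEFin.
  rewrite big_seq [RHS]big_seq; apply: eq_bigr => p /(walksP G)[q [-> oq qn]].
  by rewrite prob_cylinder// -EFinM mulrC.
have gW w : w \notin N -> g (map Some W) w = (size (undup (trajectory n w)))%:R%:E.
  rewrite -in_setC => /set_mem; rewrite /N setCK -bigcup_seq => -[p pW wp].
  rewrite wp /g big_map (bigD1_seq p) ?(walks_uniq G)//= indicE mem_set// mulr1.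
  rewrite big1 ?adde0// => q qp; rewrite indicE memNset ?mulr0//= => wq.
  by move: qp; rewrite -wq wp eqxx.
have g0 r w : (0 <= g r w)%E by apply: sume_ge0 => i _; rewrite lee_fin mulr_ge0.
have sz w : #|` walk_range X n w| = size (undup (trajectory n w)).
  by rewrite walk_rangeE card_fseq.
rewrite /mean_range unlock; apply/le_anti/andP; split.
  apply: (@le_trans _ _ (\int[P]_w g (None :: map Some W) w)%E).
    apply: ge0_le_integralT => w; first by rewrite lee_fin.
    rewrite /g big_cons -/(g _ w) /= indicE sz.
    have [wN|wN] := boolP (w \in N); last by rewrite mulr0 add0e gW.
    rewrite mulr1 (le_trans (_ : _ <= n.+1%:R%:E)%E) ?leeDl//.
    by rewrite lee_fin ler_nat (leq_trans (size_undup _))// size_mkseq.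
  by rewrite intg big_cons /= PN mule0 add0e -intg intW.
rewrite -intW; apply: ge0_le_integralT => w; first exact: g0.
have [wN|wN] := boolP (w \in N); last by rewrite gW// sz.
rewrite /g big_map big1_seq ?lee_fin// => p /andP[_ pW].
rewrite indicE memNset ?mulr0//= => wp; move/set_mem: wN; apply.
by rewrite -bigcup_seq; exists p.
Qed.

Lemma measurable_no_return (I : set nat) :
  measurable [set w | forall n, I n -> X n w <> o].
Proof.
rewrite (_ : [set _ | _] = \bigcap_(n in I) X n @^-1` (~` [set o])).
  by apply: bigcap_measurableType => // i _; exact: measurable_preimage.
by apply/seteqP; split.
Qed.

Lemma prob_no_return n :
  P [set w | forall k, (0 < k <= n)%N -> X k w <> o] = (no_return_prob E n o)%:E.
Proof.
apply: (@prob_trajectory n _ (fun p => o \notin behead p)).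
  exact: (measurable_no_return (fun k => 0 < k <= n)%N).
move=> w; rewrite /trajectory /mkseq /=; split.
  move=> wo; apply/negP => /mapP[k]; rewrite mem_iota add1n ltnS => kn wk.
  exact: (wo k).
move=> wo k kn wk; move/negP: wo; apply; apply/mapP; exists k => //.
by rewrite mem_iota add1n ltnS.
Qed.

Lemma prob_escape_le n :
  (P [set w | forall k, (0 < k)%N -> X k w <> o] <= (no_return_prob E n o)%:E)%E.
Proof.
rewrite -prob_no_return; apply: le_measure; rewrite ?inE.
- exact: (measurable_no_return (fun k => 0 < k)%N).
- exact: (measurable_no_return (fun k => 0 < k <= n)%N).
- by move=> w /= wo k /andP[k0 _]; exact: wo.
Qed.

Lemma no_return_cvg :
  (no_return_prob E n o)%:E @[n --> \oo] -->
  P [set w | forall k, (0 < k)%N -> X k w <> o].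
Proof.
pose F n := [set w | forall k, (0 < k <= n)%N -> X k w <> o].
have mF n : measurable (F n) by exact: (measurable_no_return (fun k => 0 < k <= n)%N).
have FE : \bigcap_n F n = [set w | forall k, (0 < k)%N -> X k w <> o].
  apply/seteqP; split => w /=; first by move=> Fw k k0; apply: (Fw k) => //=; rewrite k0 /=.
  by move=> Fw n _ k /andP[k0 _]; exact: Fw.
under eq_fun do rewrite -prob_no_return.
rewrite -FE; apply: nonincreasing_cvg_mu => //.
- by rewrite -ge0_fin_numE ?fin_num_measure.
- exact: bigcap_measurableType.
- move=> m n mn; apply/subsetPset => w /= Fw k /andP[k0 km].
  by apply: Fw; rewrite k0 (leq_trans km).
Qed.

End Trajectory.

(** * Isometries as graph automorphisms *)

Section GraphDistance.
Context {R : realType} {V : choiceType} {E : rel V}.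
Hypothesis Eirr : irreflexive E.

Lemma gdist_edge x y : E x y -> (gdist R E x y <= 1)%E.
Proof. by move=> xy; apply: ereal_inf_lbound; exists [:: y] => //=; rewrite xy. Qed.

Lemma edge_gdist x y : x != y -> (gdist R E x y <= 1)%E -> E x y.
Proof.
move=> xy d1; have /ereal_inf_lt[_ [p [xp pE] <-]] : (gdist R E x y < 2%:E)%E.
  by apply: le_lt_trans d1 _; rewrite lte_fin ltr1n.
rewrite lte_fin ltr_nat; case: p xp pE => [|z [|//]] /=; last first.
  by rewrite andbT => xz <-.
by move=> _ xyE; rewrite xyE eqxx in xy.
Qed.

(** For distinct vertices, adjacency means distance at most [1]; irreflexivity settles the
    diagonal. *)
Lemma isometry_edge (phi : V -> V) : bijective phi ->
  (forall y z, gdist R E y z = gdist R E (phi y) (phi z)) ->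
  forall y z, E (phi y) (phi z) = E y z.
Proof.
move=> phi_bij iso y z; have [->|yz] := eqVneq y z; first by rewrite !Eirr.
apply/idP/idP => [|/gdist_edge]; first by move=> /gdist_edge; rewrite -iso; exact: edge_gdist.
by rewrite iso; apply: edge_gdist; rewrite (inj_eq (bij_inj phi_bij)).
Qed.

Lemma vertex_transitive_graph o : symmetric E -> locally_finite E ->
  (forall x, (0 < deg E x)%N) -> vertex_transitive R E ->
  transitive_graph E (deg E o).
Proof.
move=> Esym Efin Edeg Etrans.
have aut x x' : exists phi : V -> V,
    [/\ bijective phi, phi x = x' & forall y z, E (phi y) (phi z) = E y z].
  have [phi [phi_bij phix iso]] := Etrans x x'.
  by exists phi; split=> //; exact: isometry_edge.
split=> // x; have [phi [phi_bij <- phiE]] := aut x o.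
have -> : deg E (phi x) = #|` (phi @` fset_set [set y | E x y])%fset|.
  rewrite /deg -fset_set_image; last exact: Efin.
  congr (#|` fset_set _|); apply/seteqP; split => y /=.
    have [psi phiK psiK] := phi_bij.
    by move=> xy; exists (psi y); rewrite ?psiK// -phiE psiK.
  by move=> [z xz <-]; rewrite phiE.
by rewrite card_imfset//; exact: bij_inj.
Qed.

End GraphDistance.

(** * Asymptotics *)

Section RealSequences.
Context {R : realType}.
Implicit Types u : nat -> R.

Lemma bounded_series_tail u (b tau : R) : (forall k, 0 <= u k) ->
  (forall N, \sum_(0 <= k < N) u k <= b) -> 0 < tau ->
  exists L, forall L' N, (L <= L')%N -> \sum_(L' <= k < N) u k <= tau.
Proof.
move=> u0 ub tau0; pose S : set R := range (fun N => \sum_(0 <= k < N) u k).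
have Ssup : has_sup S.
  by split; [exists (\sum_(0 <= k < 0) u k); exists 0%N|exists b => _ [N _ <-]].
have [_ [L _ <-] Ltau] := sup_adherent tau0 Ssup.
exists L => L' N LL'; have [NL|LN] := leqP N L'; first by rewrite big_geq// ltW.
have : \sum_(0 <= k < N) u k <= sup S by apply: sup_upper_bound => //; exists N.
move: Ltau; move: (sup S) => s /= {S Ssup}.
have {}LN := ltnW LN; have LN0 := leq_trans LL' LN.
rewrite (big_cat_nat (leq0n L) LN0) /= (big_cat_nat LL' LN) /=.
have : 0 <= \sum_(L <= k < L') u k by apply: sumr_ge0.
lra.
Qed.

(** Split at [M]. For [k < M] the factor [u (n - k)] is tiny, and [u 0 = 1] makes the right-hand sum
    at least [1]; for [k >= M] the factor [u k.+1] is at most [eta / 2]. *)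
Lemma convolution_small u (eta : R) : 0 < eta -> u 0%N = 1 ->
  (forall k, 0 <= u k <= 1) ->
  (forall m n, (m <= n)%N -> u n <= u m) -> u n @[n --> \oo] --> 0 ->
  exists N, forall n, (N <= n)%N ->
    \sum_(k < n.+1) u k.+1 * u (n - k)%N <= eta * \sum_(k < n.+1) u k.
Proof.
move=> eta0 u0 u01 u_le /cvgr0Pnorm_le ucvg.
have small e : 0 < e -> exists N, forall n, (N <= n)%N -> u n <= e.
  move=> e0; have [N _ Ne] := ucvg _ e0; exists N => n Nn.
  by apply: le_trans (Ne n Nn); exact: ler_norm.
have [|M uM] := small (eta / 2); first by rewrite divr_gt0.
have [|N uN] := small (eta / 2 / M.+1%:R); first by rewrite !divr_gt0.
exists (N + M)%N => n Nn; have Mn : (M <= n.+1)%N by lia.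
have b1 : 1 <= \sum_(k < n.+1) u k.
  by rewrite big_ord_recl u0 lerDl sumr_ge0// => k _; case/andP: (u01 (lift ord0 k)).
rewrite -(big_mkord xpredT (fun k => u k.+1 * u (n - k)%N)) (big_cat_nat (leq0n M) Mn) /=.
rewrite [leRHS](_ : _ = eta / 2 * (\sum_(k < n.+1) u k) +
    eta / 2 * (\sum_(k < n.+1) u k)); last by field.
apply: lerD.
  apply: (@le_trans _ _ (eta / 2)); last by rewrite ler_peMr// ltW// divr_gt0.
  apply: (@le_trans _ _ (\sum_(0 <= k < M) eta / 2 / M.+1%:R)).
    rewrite big_nat [leRHS]big_nat; apply: ler_sum => k /= kM.
    rewrite -[leRHS]mul1r; have /andP[? ?] := u01 k.+1; have /andP[? ?] := u01 (n - k)%N.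
    by apply: ler_pM => //; apply: uN; lia.
  rewrite sumr_const_nat subn0 -[_ *+ M]mulr_natr -mulrA ler_piMr//; first by rewrite ltW// divr_gt0.
  by rewrite mulrC ler_pdivrMr// mul1r ler_nat.
apply: (@le_trans _ _ (\sum_(M <= k < n.+1) eta / 2 * u (n - k)%N)).
  rewrite big_nat [leRHS]big_nat; apply: ler_sum => k /andP[Mk _].
  have /andP[? ?] := u01 (n - k)%N.
  by apply: ler_wpM2r => //; apply: uM; apply: leqW.
rewrite -mulr_sumr ler_wpM2l ?divr_ge0 ?(ltW eta0)//.
rewrite -(big_mkord xpredT u) [leRHS]big_nat_rev /= [leRHS](big_cat_nat (leq0n M) Mn) /=.
rewrite ler_wpDl//.
by apply: sumr_ge0 => k _; case/andP: (u01 (0 + n.+1 - k.+1)%N).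
Qed.

Lemma limn_einf_ge (u : nat -> \bar R) (c : \bar R) N :
  (forall n, (N <= n)%N -> (c <= u n)%E) -> (c <= limn_einf u)%E.
Proof.
move=> cu; rewrite limn_einf_lim; apply: lime_ge; first exact: is_cvg_einfs.
exists N => // n /= Nn; apply: le_ereal_inf_tmp => _ [k /= nk <-].
by apply: cu; apply: leq_trans nk.
Qed.

End RealSequences.

(** * Entropy against mean range size *)

Section EntropyRatio.
Context {R : realType} {V : choiceType} {E : rel V} {D : nat}.
Hypothesis G : transitive_graph E D.
Variable o : V.

Local Notation no_return := (no_return_prob (R := R) E).

Lemma range_ent_ge0 n : 0 <= range_ent E n o :> R.
Proof.
rewrite -[leLHS](mean_cst G n o); apply: (range_ent_ge G) => A.
rewrite -[leRHS](mean_cst G n o); apply: (le_mean G) => p _ _.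
by rewrite expR0 mulr1 lern1 leq_b1.
Qed.

(** Serves to exclude [D = 1] in the transient case. *)
Lemma no_return2 x : no_return 2 x = 1 - D%:R^-1.
Proof.
apply: (mulfI (tg_natr_neq0 (R := R) G)).
rewrite -(sum_avoid G) -(sum_nbrs_cst G x); apply: eq_big_seq => y.
rewrite (mem_nbrs G) => xy; rewrite /avoid_prob (meanS G).
transitivity (D%:R^-1 * \sum_(z <- nbrs E x) (1 - (y == z)%:R * 1) : R).
  congr (_ * _); apply: eq_bigr => z _; rewrite mean0 !inE.
  have [yx|_] := eqVneq y x; first by rewrite yx (tg_irr G) in xy.
  by case: (y == z); rewrite /= mulr1 ?subrr ?subr0.
rewrite sumrB (sum_nbrs_cst G) (sum_nbrs_eq G x y (fun=> 1)) xy mulrBr.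
by rewrite !mulr1 mulVf ?(tg_natr_neq0 G).
Qed.

Lemma transient_ratio (q : R) : 0 < q -> (forall k, q <= no_return k o) ->
  exists c N, 0 < c /\ forall n, (N <= n)%N ->
    c * \sum_(k < n.+1) no_return k o <= range_ent E n o.
Proof.
move=> q0 qo; have q_le k x : q <= no_return k x by rewrite (no_return_cst G k x o).
set d : R := D%:R; have d0 : 0 < d := tg_natr_gt0 G.
have d1 : 0 < 1 - d^-1 by rewrite -(no_return2 o) (lt_le_trans q0).
have d2 : 2 <= d.
  suff : (1 < D)%N by rewrite -(ler_nat R).
  by rewrite -(ltr_nat R) -[ltRHS]invrK invf_gt1 ?invr_gt0// -subr_gt0.
(* Min-entropy of a bit with probabilities [1/D] and [1 - 1/D], the latter being the larger as
   [D >= 2]. *)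
pose lam := - ln (1 - d^-1); have elam : expR lam = (1 - d^-1)^-1.
  by rewrite expRN lnK.
have lam0 : 0 < lam by rewrite oppr_gt0 ln_lt0// d1 ltrBlDr ltrDl invr_gt0.
(* Chosen so that the interference [d ^+ 2 * (2 * tau)] takes away half of [q ^+ 2]. *)
pose tau := q ^+ 2 / (4 * d ^+ 2).
have tau0 : 0 < tau by rewrite divr_gt0 ?exprn_gt0// mulr_gt0// exprn_gt0.
have [||L0 tail] := @bounded_series_tail R (fun k => trans_prob E k o o) q^-1 tau _ _ tau0.
- by move=> k; exact: (trans_ge0 G).
- move=> [|N]; first by rewrite big_geq// invr_ge0 ltW.
  rewrite big_mkord -[leRHS]mul1r ler_pdivlMr//; apply: le_trans (green_le G N o).
  by rewrite ler_wpM2l// sumr_ge0// => k _; exact: (trans_ge0 G).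
pose L := maxn 3 L0; have L2 : (2 < L)%N by rewrite leq_max.
have Lpos : (0 < L)%N by apply: leq_trans L2.
have tailL N x : \sum_(L <= s < N) trans_prob E s x x <= tau.
  rewrite (eq_bigr (fun s => trans_prob E s o o)); first exact/tail/leq_maxr.
  by move=> s _; exact: (trans_diag_cst G).
pose kap := d^-1 * (q ^+ 2 - d ^+ 2 * (2 * tau)).
have kapE : kap = q ^+ 2 / (2 * d) by rewrite /kap /tau; field; rewrite gt_eqF.
have kap0 : 0 < kap by rewrite kapE divr_gt0 ?exprn_gt0 ?mulr_gt0.
have L0' : 0 < L%:R :> R by rewrite ltr0n.
have c0 : 0 < lam * kap / (2 * L%:R).
  by rewrite (divr_gt0 (mulr_gt0 lam0 kap0))// mulr_gt0.
(* Each of the [M = n %/ L] excursions contributes [lam * kap], and [n.+1 <= 2 * L * M] once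
   [n >= L]. *)
exists (lam * kap / (2 * L%:R)), L; split=> //.
move=> n Ln; pose M := (n %/ L)%N.
have jn j : (j < M)%N -> ((j * L).+2 <= n)%N.
  move=> jM; apply: leq_trans (leq_trunc_div n L).
  by apply: leq_trans (leq_mul jM (leqnn L)); rewrite mulSn; lia.
apply: (@le_trans _ _ (lam * (M%:R * kap))); last first.
  have e1 : expR lam <= d.
    rewrite elam -[leRHS]invrK lef_pV2 ?posrE ?invr_gt0//.
    have : d^-1 <= 2^-1 by rewrite lef_pV2 ?posrE.
    lra.
  have e2 : expR lam * (1 - d^-1) <= 1 by rewrite elam mulVf// gt_eqF.
  apply: le_trans (range_ent_ge_tips G o L2 o jn e1 e2).
  rewrite ler_pM2l//; apply: (@le_trans _ _ (\sum_(j < M) kap)).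
    by rewrite sumr_const card_ord -[leRHS]mulr_natl.
  by apply: ler_sum => j _; apply: (mean_pick_tip_ge G o (ltW q0) q_le L2 tailL); exact: jn.
have nM : n.+1%:R <= 2 * L%:R * M%:R :> R.
  rewrite -!natrM ler_nat; have := divn_eq n L; have := ltn_pmod n Lpos.
  have : (0 < M)%N by rewrite divn_gt0.
  by rewrite -/M; nia.
have sumn : \sum_(k < n.+1) no_return k o <= n.+1%:R.
  apply: (@le_trans _ _ (\sum_(k < n.+1) 1)); last by rewrite sumr_const card_ord.
  by apply: ler_sum => k _; exact: (no_return_le1 G).
have -> : lam * (M%:R * kap) = lam * kap / (2 * L%:R) * (2 * L%:R * M%:R).
  by field; rewrite gt_eqF.
by apply: ler_wpM2l (ltW c0) _ _ (le_trans sumn nM).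
Qed.

Lemma recurrent_ratio : no_return n o @[n --> \oo] --> 0 ->
  forall eps, 0 < eps -> exists N, forall n, (N <= n)%N ->
    range_ent E n o <= eps * \sum_(k < n.+1) no_return k o.
Proof.
(* This [e] makes [- ln (1 - e)] equal to [eps / 2]; the boundary term takes the other half. *)
move=> q_cvg eps eps0; pose e : R := 1 - expR (- (eps / 2)).
have e01 : 0 < e < 1.
  rewrite subr_gt0 expR_lt1 ?oppr_lt0 ?divr_gt0//= /e.
  by rewrite ltrBlDr ltrDl expR_gt0.
have e1E : - ln (1 - e) = eps / 2 by rewrite /e opprB addrC subrK expRK opprK.
have C0 : 0 < - ln e * D%:R by rewrite mulr_gt0 ?(tg_natr_gt0 G)// oppr_gt0 ln_lt0.
have [|||||N conv] := @convolution_small R (no_return ^~ o) (eps / 2 / (- ln e * D%:R)).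
- by rewrite !divr_gt0.
- by [].
- by move=> k; rewrite (no_return_ge0 G) (no_return_le1 G).
- by move=> m n mn; exact: (no_return_le G).
- exact: q_cvg.
exists N => n Nn; apply: le_trans (range_ent_upper G n o e01) _.
rewrite e1E [leRHS](_ : _ = eps / 2 * \sum_(k < n.+1) no_return k o +
  eps / 2 * \sum_(k < n.+1) no_return k o); last by field.
rewrite lerD2l mulrA.
rewrite (eq_bigr (fun k : 'I_n.+1 => no_return k.+1 o * no_return (n - k) o))//.
apply: le_trans (ler_wpM2l (ltW C0) (conv n Nn)) _.
by rewrite mulrA [_ * (eps / 2 / _)]mulrC divfK// gt_eqF.
Qed.

End EntropyRatio.

Lemma range_ratioE (R : realType) (V : choiceType) (E : rel V) D
  (G : transitive_graph E D) (d : measure_display) (Omega : measurableType d)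
  (P : probability Omega R) (X : nat -> Omega -> V) o
  (PX : simple_random_walk E P X o) n :
  (range_entropy E P X o n / mean_range P X n)%E =
  (range_ent E n o / \sum_(k < n.+1) no_return_prob E k o)%:E
  /\ 0 < \sum_(k < n.+1) no_return_prob (R := R) E k o.
Proof.
have b0 : 0 < \sum_(k < n.+1) no_return_prob (R := R) E k o.
  rewrite big_ord_recl no_return0 ltr_pwDl// sumr_ge0// => k _.
  exact: (no_return_ge0 G).
split=> //; rewrite (range_entropyE G PX) (mean_rangeE G PX) (mean_range_size G).
by rewrite inver gt_eqF// EFinM.
Qed.

Theorem theorem1p3 (R : realType) (V : choiceType) (E : rel V)
  (Esym : symmetric E) (Eirr : irreflexive E) (Efin : locally_finite E)
  (Edeg : forall x : V, (0 < deg E x)%N)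
  (Etrans : vertex_transitive R E)
  (d : measure_display) (Omega : measurableType d)
  (P : V -> probability Omega R) (X : nat -> Omega -> V)
  (Psrw : forall o : V, simple_random_walk E (P o) X o) :
  (transient P X ->
     forall o : V,
       (0 < limn_einf (fun n : nat =>
              range_entropy E (P o) X o n / mean_range (P o) X n))%E) /\
  (recurrent P X ->
     forall o : V,
       ((fun n : nat => range_entropy E (P o) X o n / mean_range (P o) X n)%E
          @ \oo --> 0%E)).
Proof.
have G o := vertex_transitive_graph Eirr o Esym Efin Edeg Etrans.
split=> [trans_PX|rec_PX] o; have PX := Psrw o.
  set B := [set w | forall n, (0 < n)%N -> X n w <> o] in trans_PX *.
  have mB : measurable B by exact: (measurable_no_return PX (fun n => 0 < n)%N).
  have BE : ((fine (P o B))%:E = P o B)%E by rewrite fineK// fin_num_measure.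
  have q0 : 0 < fine (P o B) by rewrite -lte_fin BE; exact: trans_PX.
  have q_le k : fine (P o B) <= no_return_prob E k o.
    by rewrite -lee_fin BE; exact: (prob_escape_le (G o) PX).
  have [c [N [c0 cN]]] := transient_ratio (G o) q0 q_le.
  apply: lt_le_trans (limn_einf_ge (c := c%:E) (N := N) _); first by rewrite lte_fin.
  move=> n /cN cn; have [-> b0] := range_ratioE (G o) PX n.
  by rewrite lee_fin ler_pdivlMr.
(* By recurrence the limit of the no-return probabilities is [0]. *)
have := no_return_cvg (G o) PX; rewrite rec_PX => /fine_cvgP[_ q_cvg].
apply: cvg_EFin.
  by apply: nearW => n; have [-> _] := range_ratioE (G o) PX n.
apply/cvgr0Pnorm_le => eps eps0.
have [N Neps] := recurrent_ratio (G o) q_cvg eps0.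
exists N => // n /= /Neps; have [-> b0] := range_ratioE (G o) PX n.
by rewrite /= ger0_norm ?divr_ge0 ?(range_ent_ge0 (G o)) ?(ltW b0)// ler_pdivrMr.
Qed.
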